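(* Let $\delta>0$ and $\alpha\in(0,1)$ be fixed, and suppose the truncated kernel $\gamma_\alpha$ satisfies, for every $\boldsymbol{x}\in\Omega$, $$\int_\Omega \gamma_\alpha(\boldsymbol{x},\boldsymbol{y})\,d\boldsymbol{y}\le \frac{2}{\delta^2},\qquad \int_\Omega \gamma_\alpha(\boldsymbol{y},\boldsymbol{x})\,d\boldsymbol{y}\le K_1(\delta),\qquad \int_{\Omega_c}\frac{\gamma_\alpha(\boldsymbol{x},\boldsymbol{y})+\gamma_\alpha(\boldsymbol{y},\boldsymbol{x})}{2}\,d\boldsymbol{y}\ge K_2(\delta),$$ for some positive constants $K_1(\delta),K_2(\delta)$, and moreover $$\int_\Omega \frac{\gamma_\alpha(\boldsymbol{x},\boldsymbol{y})-\gamma_\alpha(\boldsymbol{y},\boldsymbol{x})}{2}\,d\boldsymbol{y}\ge 0\qquad\text{for all }\boldsymbol{x}\in\Omega.$$ Let $f\in L^2(\Omega)$. Then there exists a unique $u\in L^2_{n0}(\Omega)$ such that $\mathbf{B}(u,v)=\mathbf{F}(v)$ for all $v\in L^2_{n0}(\Omega)$ (the weak form of the nonlocal problem $-\mathcal{L}_{\delta,\alpha}u=f$ in $\Omega_s$, $u=0$ on $\Omega_c$), and this solution satisfies $$\|u\|_{L^2(\Omega)}\le \frac{2}{K_2(\delta)}\|f\|_{L^2(\Omega)}.$$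
   Context: Let $d\ge 1$ and let $\Omega_s\subset\mathbb{R}^d$ be a bounded Lipschitz domain. Let $\mathbf{A}(\boldsymbol{x})=(a^{i,j}(\boldsymbol{x}))_{i,j=1}^d$ be a symmetric matrix-valued function on $\mathbb{R}^d$ with Lipschitz continuous entries that is uniformly elliptic: $\lambda|\boldsymbol{\xi}|^2\le \boldsymbol{\xi}^T\mathbf{A}(\boldsymbol{x})\boldsymbol{\xi}\le\Lambda|\boldsymbol{\xi}|^2$ for all $\boldsymbol{\xi},\boldsymbol{x}\in\mathbb{R}^d$, with constants $0<\lambda\le\Lambda$. Fix $\delta>0$ and $\alpha\in(0,1)$, and let $\chi^2_\alpha(d)$ denote the $(1-\alpha)$-quantile of the chi-square distribution with $d$ degrees of freedom. Define the kernel $$\gamma(\boldsymbol{x},\boldsymbol{y})=\frac{2}{\delta^2}\,\frac{1}{\sqrt{(2\pi)^d\det(\delta^2\mathbf{A}(\boldsymbol{x}))}}\exp\Big(-\frac{(\boldsymbol{y}-\boldsymbol{x})^T\mathbf{A}(\boldsymbol{x})^{-1}(\boldsymbol{y}-\boldsymbol{x})}{2\delta^2}\Big),$$ the truncated influence region $B_{\delta,\mathbf{A},\alpha}(\boldsymbol{x})=\{\boldsymbol{y}\in\mathbb{R}^d:(\boldsymbol{y}-\boldsymbol{x})^T\mathbf{A}(\boldsymbol{x})^{-1}(\boldsymbol{y}-\boldsymbol{x})\le\delta^2\chi^2_\alpha(d)\}$, and the truncated kernel $\gamma_\alpha(\boldsymbol{x},\boldsymbol{y})=\gamma(\boldsymbol{x},\boldsymbol{y})$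 if $\boldsymbol{y}\in B_{\delta,\mathbf{A},\alpha}(\boldsymbol{x})$ and $\gamma_\alpha(\boldsymbol{x},\boldsymbol{y})=0$ otherwise. The interaction domain is $\Omega_c=\{\boldsymbol{y}\in\mathbb{R}^d\setminus\Omega_s:\exists\,\boldsymbol{x}\in\Omega_s,\ \boldsymbol{y}\in B_{\delta,\mathbf{A},\alpha}(\boldsymbol{x})\}$, and $\Omega=\Omega_s\cup\Omega_c$. The nonlocal operator is $\mathcal{L}_{\delta,\alpha}u(\boldsymbol{x})=\int_{\mathbb{R}^d}(u(\boldsymbol{y})-u(\boldsymbol{x}))\gamma_\alpha(\boldsymbol{x},\boldsymbol{y})\,d\boldsymbol{y}$. Let $L^2_{n0}(\Omega)=\{u\in L^2(\Omega): u=0 \text{ a.e. on }\Omega_c\}$, and define $$\mathbf{B}(u,v)=\int_\Omega\int_\Omega (u(\boldsymbol{x})-u(\boldsymbol{y}))v(\boldsymbol{x})\gamma_\alpha(\boldsymbol{x},\boldsymbol{y})\,d\boldsymbol{y}\,d\boldsymbol{x},\qquad \mathbf{F}(v)=\int_\Omega f(\boldsymbol{x})v(\boldsymbol{x})\,d\boldsymbol{x}.$$ *)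

(* Defs.v *)
From HB Require Import structures.
From mathcomp Require Import all_boot all_order all_algebra.
From mathcomp Require Import all_classical all_reals all_analysis.
Set Implicit Arguments. Unset Strict Implicit. Unset Printing Implicit Defensive.
Import Order.TTheory GRing.Theory Num.Theory.
Import numFieldNormedType.Exports.
Local Open Scope classical_set_scope.
Local Open Scope ring_scope.

(** * Euclidean space R^(n+1) as an iterated product measurable space
    Rd R n  ~  R * (R * ( ... * R))   (n+1 factors), with the product
    (Borel) sigma-algebra. *)
Fixpoint RdT (R : realType) (n : nat) : {d : measure_display & measurableType d} :=
  match n with
  | 0 => existT (fun d => measurableType d) _ (measurableTypeR R : measurableType _)
  | S m => existT (fun d => measurableType d) _
             ((measurableTypeR R * projT2 (RdT R m))%type : measurableType _)
  end.
Definition Rd (R : realType) (n : nat) : measurableType (projT1 (RdT R n)) :=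
  projT2 (RdT R n).

Fixpoint lebRd (R : realType) (n : nat) : set (Rd R n) -> \bar R :=
  match n return set (Rd R n) -> \bar R with
  | 0 => @lebesgue_measure R
  | S m => (@lebesgue_measure R \x @lebRd R m)%E
  end.
Arguments lebRd : clear implicits.

Fixpoint cvec (R : realType) (n : nat) : Rd R n -> 'cV[R]_n.+1 :=
  match n return Rd R n -> 'cV[R]_n.+1 with
  | 0 => fun x => \col_(i < 1) (x : R)
  | S m => fun p => col_mx (\col_(i < 1) (p.1 : R)) (@cvec R m p.2)
  end.

Definition eucl2 (R : realType) (k : nat) (v : 'cV[R]_k) : R := \sum_(i < k) v i 0 ^+ 2.
Definition quad (R : realType) (k : nat) (M : 'M[R]_k) (v : 'cV[R]_k) : R :=
  (v^T *m M *m v) 0 0.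

(** Bounded Lipschitz domain in R^(n+1) (vectors written as (t, y') with
    t the first coordinate, y' in R^n): open, connected, bounded, and near
    every boundary point p, after a rigid rotation Q, the domain is the
    region above the graph of a Lipschitz function g : R^n -> R. *)
Definition bounded_lipschitz_domain (R : realType) (n : nat) (O : set 'cV[R]_n.+1) : Prop :=
  [/\ open O, connected O, (exists M : R, forall x, O x -> `|x| <= M) &
   forall p, closure O p -> ~ O p ->
     exists r : R, 0 < r /\
     exists Q : 'M[R]_n.+1, Q^T *m Q = 1%:M /\
     exists g : 'cV[R]_n -> R,
       (exists L : R, forall a b, `|g a - g b| <= L * `|a - b|) /\
       forall y : 'cV[R]_n.+1, `|y - p| < r ->
         (O y <-> let z : 'cV[R]_(1 + n) := Q *m (y - p) in
                  g (dsubmx z) < usubmx z 0 0)].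

Definition gauss_density (R : realType) (n : nat) (z : Rd R n) : R :=
  expR (- eucl2 (cvec z) / 2) / Num.sqrt ((2 * pi) ^+ n.+1).

(** c is the (1-alpha)-quantile of the chi-square distribution with n+1
    degrees of freedom, i.e. P(|Z|^2 <= c) = 1 - alpha for Z ~ N(0, I_(n+1)). *)
Definition is_chi2_quantile (R : realType) (n : nat) (alpha c : R) : Prop :=
  (\int[lebRd R n]_(z in [set z | (eucl2 (cvec z) <= c)%R]) (gauss_density z)%:E
    = ((1 - alpha)%R)%:E)%E.

Section Kernel.
Variables (R : realType) (n : nat) (A : Rd R n -> 'M[R]_n.+1) (delta chi : R).

Definition gamma_ker (x y : Rd R n) : R :=
  2 / delta ^+ 2
  * (Num.sqrt ((2 * pi) ^+ n.+1 * \det (delta ^+ 2 *: A x)))^-1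
  * expR (- quad (invmx (A x)) (cvec y - cvec x) / (2 * delta ^+ 2)).

(** truncated influence region B_{delta,A,alpha}(x) (chi = chi^2_alpha(d)) *)
Definition infl_region (x : Rd R n) : set (Rd R n) :=
  [set y | quad (invmx (A x)) (cvec y - cvec x) <= delta ^+ 2 * chi].

Definition gamma_trunc (x y : Rd R n) : R :=
  if quad (invmx (A x)) (cvec y - cvec x) <= delta ^+ 2 * chi
  then gamma_ker x y else 0.

Variable Omega_s : set 'cV[R]_n.+1.

Definition Os : set (Rd R n) := [set x | Omega_s (cvec x)].
Definition Oc : set (Rd R n) :=
  [set y | ~ Os y /\ exists x, Os x /\ infl_region x y].
Definition Om : set (Rd R n) := Os `|` Oc.

Definition L2 (u : Rd R n -> R) : Prop :=
  measurable_fun Om u /\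
  (\int[lebRd R n]_(x in Om) ((u x ^+ 2)%R)%:E < +oo)%E.
Definition L2n0 (u : Rd R n -> R) : Prop :=
  L2 u /\ (lebRd R n).-negligible [set x | Oc x /\ u x <> 0].
Definition L2norm (u : Rd R n -> R) : R :=
  Num.sqrt (fine (\int[lebRd R n]_(x in Om) ((u x ^+ 2)%R)%:E)).

Definition Bform (u v : Rd R n -> R) : \bar R :=
  (\int[lebRd R n]_(x in Om)
     \int[lebRd R n]_(y in Om) (((u x - u y) * v x * gamma_trunc x y)%R)%:E)%E.
Definition Fform (f v : Rd R n -> R) : \bar R :=
  (\int[lebRd R n]_(x in Om) ((f x * v x)%R)%:E)%E.

End Kernel.

(* Main.v *)
(** On Omega_s the weak equation reads a u = f + K u, where
    K u (x) = \int_Omega gamma_alpha(x, y) u(y) dy and a = K 1.  Since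
    2 W(x) W(y) <= W(x)^2 + W(y)^2, the hypotheses on the kernel give, for every
    W >= 0 vanishing off Omega_s, the coercivity inequality
    \int W K W + K2 \int W^2 <= \int a W^2, in which all terms are integrals of
    nonnegative functions.  Hence a square-integrable subsolution
    a W <= F + K W satisfies K2 ||W|| <= ||F||.

    For f >= 0 the solution is the increasing limit of the iterates
    u_0 = 0, u_(k+1) = (f + K u_k) / a: by monotonicity every u_k is a
    subsolution, so the bound is uniform in k and passes to the limit by monotone
    convergence, without completeness of L^2 or the Lax-Milgram theorem.  A general
    f is split into positive and negative parts.  For uniqueness, testing with the
    residual turns the weak equation into a pointwise one, and the modulus of the
    difference of two solutions is a subsolution with F = 0. *)
Require Import Defs.
From HB Require Import structures.
From mathcomp Require Import all_boot all_order all_algebra.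
From mathcomp Require Import all_classical all_reals all_analysis.
From mathcomp Require Import measurable_realfun ring lra.
Set Implicit Arguments.
Unset Strict Implicit.
Unset Printing Implicit Defensive.
Import Order.TTheory GRing.Theory Num.Theory.
Import numFieldNormedType.Exports.
Local Open Scope classical_set_scope.
Local Open Scope ring_scope.

(** * Positive integral operators *)

(** The coercivity constant comes from comparing masses. For [x] in [S], which stands for Omega_s,
    the interactions of [x] with [S] in both directions are the row mass plus the column mass minus
    the two masses over Omega_c. The latter sum to at least [2 * K2], and the sign of the
    antisymmetric part bounds the column mass by the row mass [a x]; hence the interactions inside
    [S] amount to at most [2 * a x - 2 * K2]. The obstacle is the form infinity minus infinity. [K]
    is therefore applied only to nonnegative extended-valued functions, and signed functions enter
    through a difference of two nonnegative ones. The one cancellation in the energy bound removes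
    [\int W K W], so [W] must be known to be square-integrable beforehand. For an iterate this is
    Schur's test, where the row and column bounds enter; the estimate it gives may grow with [k], as
    only its finiteness matters. Using Tonelli's theorem also requires that [lebRd] carry the
    structure of a sigma-finite measure and that the kernel and the interaction domain be
    measurable, none of which is immediate from the definitions. *)

Lemma ge0_mule_add_le_sqr (R : realType) (a b : \bar R) :
  (0 <= a -> 0 <= b -> a * b + a * b <= a * a + b * b)%E.
Proof.
case: a b => [a| |] [b| |] //= a0 b0.
- by rewrite -!EFinM -!EFinD lee_fin; have := sqr_ge0 (a - b); nra.
- by rewrite mulyy addey ?leey // -?EFinM.
- by rewrite mulyy addye ?leey // -?EFinM.
Qed.

(** Young's inequality with a free parameter, infinite values allowed. It replaces Cauchy-Schwarz
    twice: with [b = 1] in Schur's test and with [c = K2] in the energy bound. *)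
Lemma ge0_mule_le_Msqr (R : realType) (c : R) (a b : \bar R) : 0 < c ->
  (0 <= a -> 0 <= b ->
   (2 * c)%:E * (a * b) <= a * a + (c * c)%:E * (b * b))%E.
Proof.
move=> c0 a0 b0.
have cb0 : (0 <= c%:E * b)%E by rewrite mule_ge0 // lee_fin ltW.
have := @ge0_mule_add_le_sqr R a (c%:E * b)%E a0 cb0.
suff [-> ->] : (a * (c%:E * b) + a * (c%:E * b) = (2 * c)%:E * (a * b) /\
  c%:E * b * (c%:E * b) = (c * c)%:E * (b * b))%E by [].
split; last by rewrite muleACA EFinM.
have -> : (2 * c)%:E = (c%:E + c%:E)%E by rewrite -EFinD mulr2n mulrDl mul1r.
by rewrite ge0_muleDl ?lee_fin ?(ltW c0)// (muleCA a).
Qed.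

Lemma ge0_sqreD_le (R : realType) (a b : \bar R) :
  (0 <= a -> 0 <= b -> (a + b) * (a + b) <= 2%:E * (a * a + b * b))%E.
Proof.
have E2 : (2%:E * +oo = +oo :> \bar R)%E by rewrite gt0_muley // lte_fin.
case: a b => [a| |] [b| |] //= a0 b0.
- by rewrite lee_fin; have := sqr_ge0 (a - b); nra.
- by rewrite mulyy [in leRHS]addey -?EFinM // E2 leey.
- by rewrite mulyy [in leRHS]addye -?EFinM // E2 leey.
- by rewrite mulyy [in leRHS]addye // E2 leey.
Qed.

Lemma cvg_sqre (R : realType) (u : nat -> \bar R) (l : \bar R) :
  (forall k, 0 <= u k)%E -> u k @[k --> \oo] --> l ->
  (u k * u k)%E @[k --> \oo] --> (l * l)%E.
Proof.
move=> u0 ul; apply: cvgeM => //.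
(* The product [l * l] is never the undefined form [0 * +oo]. *)
by case: l {ul} => [r| |].
Qed.

(** Reduced to real powers of the nonnegative base [f * f]. The identity [f^-1 = f * (f * f)^-1]
    survives at the zeros of [f], where both sides are [0]. *)
Lemma measurable_funV d (T : measurableType d) (R : realType) (f : T -> R) :
  measurable_fun setT f -> measurable_fun setT (fun x => (f x)^-1).
Proof.
move=> mf.
have -> : (fun x => (f x)^-1) = (fun x => f x * (f x * f x) `^ (- 1)).
  apply/funext => x; rewrite powR_inv1 -?expr2 ?sqr_ge0//.
  by have [->|f0] := eqVneq (f x) 0; [rewrite invr0 mul0r|field].
apply: measurable_funM => //.
apply: (measurableT_comp (measurable_powR _)); exact: measurable_funM.
Qed.

Section nonneg_integrals.
Context d (T : measurableType d) (R : realType).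
Variable mu : {measure set T -> \bar R}.

Lemma cvg_integral_nondecreasing (g : nat -> T -> \bar R) (h : T -> \bar R) :
  (forall k, measurable_fun setT (g k)) -> (forall k x, 0 <= g k x)%E ->
  (forall k x, g k x <= g k.+1 x)%E ->
  (forall x, g k x @[k --> \oo] --> h x) ->
  (\int[mu]_x g k x)%E @[k --> \oo] --> (\int[mu]_x h x)%E.
Proof.
move=> mg g0 gS gh.
have -> : (\int[mu]_x h x = \int[mu]_x limn (g ^~ x))%E.
  by apply: eq_integral => x _; rewrite (cvg_lim _ (gh x)).
apply: cvg_monotone_convergence => // x _.
exact/nondecreasing_seqP.
Qed.

Lemma ge0_le_integralT (f g : T -> \bar R) :
  measurable_fun setT f -> measurable_fun setT g ->
  (forall x, 0 <= f x)%E -> (forall x, f x <= g x)%E ->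
  (\int[mu]_x f x <= \int[mu]_x g x)%E.
Proof. by move=> mf mg f0 fg; apply: ge0_le_integral. Qed.

End nonneg_integrals.

Section kernel_operator.
Context d (T : measurableType d) (R : realType).
Variable mu : {sigma_finite_measure set T -> \bar R}.
Variable G : T -> T -> R.
Hypothesis G0 : forall x y, 0 <= G x y.
Hypothesis mG : measurable_fun setT (fun z : T * T => G z.1 z.2).

(** Extended values make the operator total on nonnegative measurable functions and compatible with
    increasing limits; finiteness is established separately, almost everywhere. *)
Definition kop (w : T -> \bar R) (x : T) : \bar R :=
  (\int[mu]_y ((G x y)%:E * w y))%E.
Definition kop_tr (w : T -> \bar R) (y : T) : \bar R :=
  (\int[mu]_x ((G x y)%:E * w x))%E.

Lemma measurable_GM (w : T * T -> \bar R) : measurable_fun setT w ->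
  measurable_fun setT (fun z : T * T => (G z.1 z.2)%:E * w z)%E.
Proof. by move=> mw; apply: emeasurable_funM => //; exact/measurable_EFinP. Qed.

Lemma measurable_GM1 (w : T -> \bar R) : measurable_fun setT w ->
  measurable_fun setT (fun z : T * T => (G z.1 z.2)%:E * w z.1)%E.
Proof. by move=> mw; apply: measurable_GM; exact: measurableT_comp. Qed.

Lemma measurable_GM2 (w : T -> \bar R) : measurable_fun setT w ->
  measurable_fun setT (fun z : T * T => (G z.1 z.2)%:E * w z.2)%E.
Proof. by move=> mw; apply: measurable_GM; exact: measurableT_comp. Qed.

Lemma measurable_Gx x : measurable_fun setT (G x).
Proof. exact: (measurableT_comp mG (measurable_pair1 x)). Qed.

Lemma measurable_Gy y : measurable_fun setT (G ^~ y).
Proof. exact: (measurableT_comp mG (measurable_pair2 y)). Qed.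

Lemma measurable_GMx (w : T -> \bar R) x : measurable_fun setT w ->
  measurable_fun setT (fun y => (G x y)%:E * w y)%E.
Proof.
move=> mw; apply: emeasurable_funM => //.
exact/measurable_EFinP/measurable_Gx.
Qed.

Lemma measurable_GMy (w : T -> \bar R) y : measurable_fun setT w ->
  measurable_fun setT (fun x => (G x y)%:E * w x)%E.
Proof.
move=> mw; apply: emeasurable_funM => //.
exact/measurable_EFinP/measurable_Gy.
Qed.

Section nonneg.
Variable w : T -> \bar R.
Hypotheses (mw : measurable_fun setT w) (w0 : forall x, (0 <= w x)%E).

Lemma kop_ge0 x : (0 <= kop w x)%E.
Proof. by apply: integral_ge0 => y _; rewrite mule_ge0 ?lee_fin. Qed.

Lemma kop_tr_ge0 x : (0 <= kop_tr w x)%E.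
Proof. by apply: integral_ge0 => y _; rewrite mule_ge0 ?lee_fin. Qed.

Lemma measurable_kop : measurable_fun setT (kop w).
Proof.
apply: (@measurable_fun_fubini_tonelli_F _ _ _ _ _ mu
  (fun z : T * T => (G z.1 z.2)%:E * w z.2)%E); first exact: measurable_GM2.
by move=> z; rewrite mule_ge0 ?lee_fin.
Qed.

Lemma measurable_kop_tr : measurable_fun setT (kop_tr w).
Proof.
apply: (@measurable_fun_fubini_tonelli_G _ _ _ _ _ mu
  (fun z : T * T => (G z.1 z.2)%:E * w z.1)%E); first exact: measurable_GM1.
by move=> z; rewrite mule_ge0 ?lee_fin.
Qed.

End nonneg.

(** Tonelli's theorem, which is why [mu] is sigma-finite and [G] jointly measurable. *)
Lemma kop_adjoint (v w : T -> \bar R) :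
  measurable_fun setT v -> measurable_fun setT w ->
  (forall x, 0 <= v x)%E -> (forall x, 0 <= w x)%E ->
  (\int[mu]_x (v x * kop w x) = \int[mu]_y (w y * kop_tr v y))%E.
Proof.
move=> mv mw v0 w0.
transitivity (\int[mu]_x \int[mu]_y (v x * ((G x y)%:E * w y)))%E.
  apply: eq_integral => x _; rewrite -ge0_integralZl//.
    exact: measurable_GMx.
  by move=> y _; rewrite mule_ge0 ?lee_fin.
have := @fubini_tonelli _ _ _ _ _ mu mu
  (fun z : T * T => v z.1 * ((G z.1 z.2)%:E * w z.2))%E.
move=> /= ->.
- apply: eq_integral => y _; rewrite -ge0_integralZl//.
  + by apply: eq_integral => x _; rewrite muleCA [RHS]muleCA (muleC (v x)).
  + exact: measurable_GMy.
  + by move=> x _; rewrite mule_ge0 ?lee_fin.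
- apply: emeasurable_funM; first exact: measurableT_comp.
  exact: measurable_GM2.
- by move=> z; rewrite !mule_ge0 ?lee_fin.
Qed.

Lemma kop_mono (v w : T -> \bar R) x :
  measurable_fun setT v -> measurable_fun setT w ->
  (forall x, 0 <= v x)%E -> (forall x, v x <= w x)%E ->
  (kop v x <= kop w x)%E.
Proof.
move=> mv mw v0 vw; apply: ge0_le_integralT; try exact: measurable_GMx.
- by move=> y; rewrite mule_ge0 ?lee_fin.
- by move=> y; rewrite lee_wpmul2l ?lee_fin.
Qed.

Lemma cvg_kop (w : nat -> T -> \bar R) (l : T -> \bar R) x :
  (forall k, measurable_fun setT (w k)) -> (forall k x, 0 <= w k x)%E ->
  (forall k x, w k x <= w k.+1 x)%E ->
  (forall x, w k x @[k --> \oo] --> l x) ->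
  kop (w k) x @[k --> \oo] --> kop l x.
Proof.
move=> mw w0 wS wl; apply: cvg_integral_nondecreasing => [k|k y|k y|y].
- exact: measurable_GMx.
- by rewrite mule_ge0 ?lee_fin.
- by rewrite lee_wpmul2l ?lee_fin.
- exact: cvgeZl.
Qed.

End kernel_operator.

(** * Coercivity and nonnegative solutions *)

Section dissipative_kernel.
Context d (T : measurableType d) (R : realType).
Variable mu : {sigma_finite_measure set T -> \bar R}.
Variable G : T -> T -> R.
Hypothesis G0 : forall x y, 0 <= G x y.
Hypothesis mG : measurable_fun setT (fun z : T * T => G z.1 z.2).
Variables (S : set T) (M K1 K2 : R).
Hypotheses (mS : measurable S) (M0 : 0 < M) (K10 : 0 < K1) (K20 : 0 < K2).

Local Notation K := (kop mu G).
Local Notation a := (kop mu G (cst 1%E)).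
Local Notation at_ := (kop_tr mu G (cst 1%E)).
Local Notation chiS := (fun x : T => (\1_S x : R)%:E).

Hypothesis row_le : forall x, (a x <= M%:E)%E.
Hypothesis col_le : forall y, (at_ y <= K1%:E)%E.
(** The bound [K 1_S + K^T 1_S <= 2 * (a - K2)], with the subtraction moved across because the terms
    are extended reals. *)
Hypothesis dissip : forall x, S x ->
  (K chiS x + kop_tr mu G chiS x + (2 * K2)%:E <= 2%:E * a x)%E.

Let a_ge0 x : (0 <= a x)%E.
Proof. exact: kop_ge0. Qed.

Let m1 : measurable_fun setT (cst 1%E : T -> \bar R).
Proof. exact: measurable_cst. Qed.

Let ma : measurable_fun setT a.
Proof. exact: measurable_kop. Qed.

Let mchiS : measurable_fun setT chiS.
Proof. exact/measurable_EFinP/measurable_indic. Qed.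

Let chiS_ge0 x : (0 <= chiS x)%E.
Proof. by rewrite lee_fin. Qed.

(** The product inequality is used in the localised form [2 W(x) W(y) <= W(x)^2 1_S(y) + 1_S(x)
    W(y)^2]. Only interactions inside [S] are charged this way, and by [dissip] what [a] contains
    beyond them pays for the [K2] term. *)
Lemma coercive (W : T -> \bar R) : measurable_fun setT W ->
  (forall x, 0 <= W x)%E -> (forall x, ~ S x -> W x = 0)%E ->
  (\int[mu]_x (W x * K W x) + K2%:E * \int[mu]_x (W x * W x)
    <= \int[mu]_x (a x * (W x * W x)))%E.
Proof.
move=> mW W0 WS.
have WW0 x : (0 <= W x * W x)%E by rewrite mule_ge0.
have mWW : measurable_fun setT (fun x => W x * W x)%E by exact: emeasurable_funM.
have KW0 x : (0 <= K W x)%E by exact: kop_ge0.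
have mKW : measurable_fun setT (K W) by exact: measurable_kop.
have WKW0 x : (0 <= W x * K W x)%E by rewrite mule_ge0.
have mWKW : measurable_fun setT (fun x => W x * K W x)%E by exact: emeasurable_funM.
have Wchi x : (W x * chiS x = W x)%E.
  rewrite indicE; have [Sx|Sx] := pselect (S x); first by rewrite mem_set// mule1.
  by rewrite memNset// mule0 WS.
pose b x := (K chiS x + kop_tr mu G chiS x)%E.
have b0 x : (0 <= b x)%E by rewrite adde_ge0 ?kop_ge0 ?kop_tr_ge0.
have mb : measurable_fun setT b.
  by apply: emeasurable_funD; [exact: measurable_kop|exact: measurable_kop_tr].
have two_int : (2%:E * \int[mu]_x (W x * K W x) <= \int[mu]_x (W x * W x * b x))%E.
  have -> : (\int[mu]_x (W x * W x * b x) =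
      \int[mu]_x \int[mu]_y ((G x y)%:E * (W x * W x * chiS y + chiS x * (W y * W y))))%E.
    transitivity (\int[mu]_x ((W x * W x) * K chiS x + chiS x * K (fun y => W y * W y) x))%E.
      rewrite ge0_integralD//; last 4 first.
      - by move=> x _; rewrite mule_ge0 ?kop_ge0.
      - by apply: emeasurable_funM => //; exact: measurable_kop.
      - by move=> x _; rewrite mule_ge0 ?kop_ge0.
      - by apply: emeasurable_funM => //; exact: measurable_kop.
      (* Adjointness trades [1_S * K (W^2)] for [W^2 * K^T 1_S], so that both weights multiply [W^2]
         at the same point and add up to [b]. *)
      rewrite [X in (_ + X)%E](@kop_adjoint _ _ _ mu G G0 mG chiS (fun y => W y * W y)%E)//.
      rewrite -ge0_integralD//; last 4 first.
      - by move=> x _; rewrite mule_ge0 ?kop_ge0.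
      - by apply: emeasurable_funM => //; exact: measurable_kop.
      - by move=> x _; rewrite mule_ge0 ?kop_tr_ge0.
      - by apply: emeasurable_funM => //; exact: measurable_kop_tr.
      apply: eq_integral => x _; rewrite /b ge0_muleDr ?kop_ge0 ?kop_tr_ge0//.
    apply: eq_integral => x _; rewrite /kop -!ge0_integralZl//; last 4 first.
    - exact: measurable_GMx.
    - by move=> y _; rewrite mule_ge0 ?lee_fin.
    - exact: measurable_GMx.
    - by move=> y _; rewrite mule_ge0 ?lee_fin.
    rewrite -ge0_integralD//; last 4 first.
    - by move=> y _; rewrite !mule_ge0 ?lee_fin.
    - by apply: measurable_funeM; exact: measurable_GMx.
    - by move=> y _; rewrite !mule_ge0 ?lee_fin.
    - by apply: measurable_funeM; exact: measurable_GMx.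
    apply: eq_integral => y _.
    rewrite ge0_muleDr//; last 2 first.
    - by rewrite !mule_ge0 ?lee_fin.
    - by rewrite !mule_ge0 ?lee_fin.
    by congr (_ + _)%E; rewrite muleCA.
  rewrite -ge0_integralZl//.
  apply: ge0_le_integralT.
  - exact: measurable_funeM.
  - apply: (@measurable_fun_fubini_tonelli_F _ _ _ _ _ mu
     (fun z : T * T => (G z.1 z.2)%:E * (W z.1 * W z.1 * chiS z.2 + chiS z.1 * (W z.2 * W z.2)))%E).
      apply: measurable_GM => //; apply: emeasurable_funD; apply: emeasurable_funM.
      - exact: (measurableT_comp mWW).
      - exact: (measurableT_comp mchiS).
      - exact: (measurableT_comp mchiS).
      - exact: (measurableT_comp mWW).
    by move=> z; rewrite mule_ge0 ?lee_fin ?adde_ge0 // !mule_ge0.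
  - by move=> x; rewrite mule_ge0.
  - move=> x; rewrite /kop.
    rewrite -ge0_integralZl//; last 2 first.
    - exact: measurable_GMx.
    - by move=> y _; rewrite mule_ge0 ?lee_fin.
    rewrite -ge0_integralZl//; last 2 first.
    - by apply: measurable_funeM; exact: measurable_GMx.
    - by move=> y _; rewrite !mule_ge0 ?lee_fin.
    apply: ge0_le_integralT.
    - by do 2 apply: measurable_funeM; exact: measurable_GMx.
    - apply: measurable_GMx => //; apply: emeasurable_funD; apply: emeasurable_funM => //.
    - by move=> y; rewrite !mule_ge0 ?lee_fin.
    move=> y; rewrite (muleCA (W x)) (muleCA 2%:E); apply: lee_wpmul2l; rewrite ?lee_fin//.
    have -> : (2%:E * (W x * W y) = (W x * W y) + (W x * W y))%E.
      by rewrite -[2%R]/(1 + 1) EFinD ge0_muleDl ?mul1e.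
    case: (pselect (S x)) => Sx; last by rewrite WS// mul0e adde0 adde_ge0 ?mule_ge0.
    case: (pselect (S y)) => Sy; last by rewrite (WS y)// mule0 adde0 adde_ge0 ?mule_ge0.
    rewrite !indicE !mem_set// mule1 mul1e; exact: ge0_mule_add_le_sqr.
have KWW0 : (0 <= K2%:E * \int[mu]_x (W x * W x))%E.
  by rewrite mule_ge0 ?lee_fin ?(ltW K20)// integral_ge0.
(* Doubling both sides matches [two_int] and the factor 2 in [dissip]. *)
rewrite -(@lee_pmul2l _ 2%:E) ?lte_fin//.
rewrite ge0_muleDr//; last exact: integral_ge0.
apply: (@le_trans _ _ (\int[mu]_x (W x * W x * b x) + \int[mu]_x ((2 * K2)%:E * (W x * W x)))%E).
  rewrite leeD// muleA -EFinM ge0_integralZl// lee_fin mulr_ge0 ?ltW//.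
rewrite -ge0_integralD//; last 4 first.
- by move=> x _; rewrite mule_ge0.
- exact: emeasurable_funM.
- by move=> x _; rewrite mule_ge0// lee_fin mulr_ge0 ?ltW.
- exact: measurable_funeM.
rewrite -ge0_integralZl//; last 2 first.
- exact: emeasurable_funM.
- by move=> x _; rewrite mule_ge0.
apply: ge0_le_integralT.
- by apply: emeasurable_funD; [exact: emeasurable_funM|exact: measurable_funeM].
- by apply: measurable_funeM; exact: emeasurable_funM.
- by move=> x; rewrite adde_ge0// mule_ge0// lee_fin mulr_ge0 ?ltW.
move=> x; case: (pselect (S x)) => Sx; last by rewrite WS// !mul0e !mule0 adde0.
rewrite (muleC (2 * K2)%:E) -ge0_muleDr//; last by rewrite lee_fin mulr_ge0 ?ltW.
by rewrite muleA (muleC (_ * a x)%E) lee_wpmul2l// dissip.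
Qed.

(* Pointwise (K w)^2 <= M K(w^2), from Young's inequality with the constant
   c = K w / M (any c > 0 shows that K(w^2) is infinite when K w is). *)
Lemma schur (w : T -> \bar R) : measurable_fun setT w -> (forall x, 0 <= w x)%E ->
  (\int[mu]_x (K w x * K w x) <= (M * K1)%:E * \int[mu]_x (w x * w x))%E.
Proof.
move=> mw w0.
have ww0 x : (0 <= w x * w x)%E by rewrite mule_ge0.
have mww : measurable_fun setT (fun x => w x * w x)%E by exact: emeasurable_funM.
have mKw : measurable_fun setT (K w) by exact: measurable_kop.
have mKww : measurable_fun setT (K (fun x => w x * w x)%E) by exact: measurable_kop.
have Kww0 x : (0 <= K (fun x => w x * w x)%E x)%E by exact: kop_ge0.
have young c x : 0 < c ->
    ((2 * c)%:E * K w x <= K (fun x => w x * w x)%E x + (c * c * M)%:E)%E.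
  move=> c0; have c20 : 0 <= c * c by rewrite mulr_ge0// ltW.
  apply: (@le_trans _ _ (K (fun x => w x * w x)%E x + (c * c)%:E * a x)%E); last first.
    by rewrite leeD2l// (EFinM _ M) lee_wpmul2l// lee_fin.
  rewrite /kop -!ge0_integralZl ?lee_fin ?mulr_ge0 ?(ltW c0)//; last 4 first.
  - exact: measurable_GMx.
  - by move=> y _; rewrite mule_ge0 ?lee_fin.
  - exact: measurable_GMx.
  - by move=> y _; rewrite mule_ge0 ?lee_fin.
  rewrite -ge0_integralD//; last 4 first.
  - by move=> y _; rewrite mule_ge0 ?lee_fin.
  - exact: measurable_GMx.
  - by move=> y _; rewrite !mule_ge0 ?lee_fin.
  - by apply: measurable_funeM; exact: measurable_GMx.
  apply: ge0_le_integralT.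
  - by apply: measurable_funeM; exact: measurable_GMx.
  - by apply: emeasurable_funD; [|apply: measurable_funeM]; exact: measurable_GMx.
  - by move=> y; rewrite !mule_ge0 ?lee_fin// mulr_ge0 ?ltW.
  move=> y; rewrite muleCA (muleCA (c * c)%:E) -ge0_muleDr//; last first.
    by rewrite mule_ge0 ?lee_fin.
  apply: lee_wpmul2l; rewrite ?lee_fin//.
  by have := @ge0_mule_le_Msqr R c (w y) 1%E c0 (w0 y) (@lee01 R); rewrite !mule1.
have pointwise x : (K w x * K w x <= M%:E * K (fun x => w x * w x)%E x)%E.
  have := kop_ge0 mu G0 w0 x.
  case E : (K w x) => [r| |] // r0.
  (* The value [r = 0] is set apart because [c = r / M] has to be positive. *)
  - rewrite lee_fin in r0; case: (ltgtP 0 r) r0 => // [r0 _|<- _]; last first.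
      by rewrite mule0 mule_ge0 ?lee_fin ?(ltW M0).
    have := young (r / M) x; rewrite E => /(_ (divr_gt0 r0 M0)).
    move: (Kww0 x); case: (K _ x) => [s| |] // s0; last by rewrite gt0_muley ?leey ?lte_fin.
    rewrite !lee_fin.
    have -> : 2 * (r / M) * r = 2 * (r * r / M) by field; rewrite gt_eqF.
    have -> : r / M * (r / M) * M = r * r / M by field; rewrite gt_eqF.
    move=> h; have {h} : r * r / M <= s by lra.
    by rewrite ler_pdivrMr// (mulrC M).
  - have := young 1 x; rewrite E gt0_muley ?lte_fin// => /(_ ltr01).
    move: (Kww0 x); case: (K _ x) => [s| |] // _.
    by rewrite (gt0_muley (x := M%:E)) ?lte_fin// leey.
have MK1 : (\int[mu]_x (M%:E * K (fun x => w x * w x)%E x) <=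
    (M * K1)%:E * \int[mu]_x (w x * w x))%E.
  rewrite ge0_integralZl ?lee_fin ?(ltW M0)// EFinM -muleA lee_wpmul2l ?lee_fin ?(ltW M0)//.
  have -> : (\int[mu]_x K (fun x => w x * w x) x = \int[mu]_x (1 * K (fun x => w x * w x) x))%E.
    by apply: eq_integral => x _; rewrite mul1e.
  (* Pairing with the constant 1 turns the operator into the weight [at_], the column mass, which
     [K1] bounds. *)
  rewrite (@kop_adjoint _ _ _ mu G G0 mG (cst 1%E) (fun y => w y * w y)%E)// -ge0_integralZl ?lee_fin ?(ltW K10)//.
  apply: ge0_le_integralT => //.
  - by apply: emeasurable_funM => //; exact: measurable_kop_tr.
  - exact: measurable_funeM.
  - by move=> x; rewrite mule_ge0// kop_tr_ge0.
  - by move=> x; rewrite muleC lee_wpmul2r.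
apply: le_trans MK1; apply: ge0_le_integralT => //.
- exact: emeasurable_funM.
- exact: measurable_funeM.
- by move=> x; rewrite mule_ge0 ?kop_ge0.
Qed.

(** Multiplying the subsolution inequality by [W] gives [\int a W^2 <= \int F W + \int W K W].
    Comparison with [coercive] cancels the last term and leaves [K2 \int W^2 <= \int F W]; Young's
    inequality with parameter [K2] then eliminates the mixed integral. *)
Lemma subsolution_bound (F W : T -> \bar R) :
  measurable_fun setT F -> (forall x, 0 <= F x)%E ->
  measurable_fun setT W -> (forall x, 0 <= W x)%E ->
  (forall x, ~ S x -> W x = 0)%E -> (\int[mu]_x (W x * W x) < +oo)%E ->
  {ae mu, forall x, S x -> (a x * W x <= F x + K W x)%E} ->
  ((K2 * K2)%:E * \int[mu]_x (W x * W x) <= \int[mu]_x (F x * F x))%E.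
Proof.
move=> mF F0 mW W0 WS Wfin Wsub.
have WW0 x : (0 <= W x * W x)%E by rewrite mule_ge0.
have mWW : measurable_fun setT (fun x => W x * W x)%E by exact: emeasurable_funM.
have KW0 x : (0 <= K W x)%E by exact: kop_ge0.
have mKW : measurable_fun setT (K W) by exact: measurable_kop.
have WKW0 x : (0 <= W x * K W x)%E by rewrite mule_ge0.
have mWKW : measurable_fun setT (fun x => W x * K W x)%E by exact: emeasurable_funM.
have FW0 x : (0 <= F x * W x)%E by rewrite mule_ge0.
have mFW : measurable_fun setT (fun x => F x * W x)%E by exact: emeasurable_funM.
have FF0 x : (0 <= F x * F x)%E by rewrite mule_ge0.
have mFF : measurable_fun setT (fun x => F x * F x)%E by exact: emeasurable_funM.
have aWW0 x : (0 <= a x * (W x * W x))%E by rewrite mule_ge0.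
have maWW : measurable_fun setT (fun x => a x * (W x * W x))%E by exact: emeasurable_funM.
have aWW : (\int[mu]_x (a x * (W x * W x)) <=
    \int[mu]_x (F x * W x) + \int[mu]_x (W x * K W x))%E.
  rewrite -ge0_integralD//; apply: ae_ge0_le_integral => //.
  - by move=> x _; rewrite adde_ge0.
  - exact: emeasurable_funD.
  apply: filterS Wsub => x Wsub _.
  have [Sx|Sx] := pselect (S x); last by rewrite WS// !mule0 mul0e adde0.
  by rewrite (muleC (F x)) -ge0_muleDr// muleCA lee_wpmul2l// Wsub.
have Q0 : (0 <= \int[mu]_x (F x * W x))%E by exact: integral_ge0.
have A0 : (0 <= \int[mu]_x (F x * F x))%E by exact: integral_ge0.
have P0 : (0 <= \int[mu]_x (W x * K W x))%E by exact: integral_ge0.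
have N0 : (0 <= \int[mu]_x (W x * W x))%E by exact: integral_ge0.
have K2N0 : (0 <= K2%:E * \int[mu]_x (W x * W x))%E by rewrite mule_ge0 ?lee_fin ?(ltW K20).
have aWWfin : (\int[mu]_x (a x * (W x * W x)) < +oo)%E.
  apply: (@le_lt_trans _ _ (M%:E * \int[mu]_x (W x * W x))%E).
    rewrite -ge0_integralZl ?lee_fin ?(ltW M0)//; apply: ge0_le_integralT => //.
    - exact: measurable_funeM.
    - by move=> x; rewrite lee_wpmul2r.
  by rewrite lte_mul_pinfty ?lee_fin ?(ltW M0).
have coe := coercive mW W0 WS.
(* Coercivity bounds this integral by [\int a W^2], finite by the row bound. The cancellation in
   [K2N] depends on it. *)
have Pfin : (\int[mu]_x (W x * K W x))%E \is a fin_num.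
  rewrite ge0_fin_numE//; apply: le_lt_trans aWWfin; apply: le_trans coe.
  by rewrite leeDl.
have K2N : (K2%:E * \int[mu]_x (W x * W x) <= \int[mu]_x (F x * W x))%E.
  have := le_trans coe aWW; rewrite [in leRHS]addeC.
  by rewrite leeD2lE.
have young : ((2 * K2)%:E * \int[mu]_x (F x * W x) <=
    \int[mu]_x (F x * F x) + (K2 * K2)%:E * \int[mu]_x (W x * W x))%E.
  have K22 : 0 <= K2 * K2 by rewrite mulr_ge0// ltW.
  have K21 : 0 <= 2 * K2 by rewrite mulr_ge0// ltW.
  rewrite -!ge0_integralZl ?lee_fin// -ge0_integralD//; last 2 first.
  - by move=> x _; rewrite mule_ge0 ?lee_fin.
  - exact: measurable_funeM.
  apply: ge0_le_integralT.
  - exact: measurable_funeM.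
  - by apply: emeasurable_funD => //; exact: measurable_funeM.
  - by move=> x; rewrite mule_ge0 ?lee_fin.
  - by move=> x; exact: ge0_mule_le_Msqr.
have K21 : (0 <= (2 * K2)%:E)%E by rewrite lee_fin pmulr_rge0// ltW.
(* With [N = \int W^2] and [A = \int F^2] this reads [2 K2^2 N <= A + K2^2 N]; since [N] is finite,
   one copy of [K2^2 N] can be subtracted. *)
have := le_trans (lee_wpmul2l K21 K2N) young.
move: N0 Wfin A0.
case: (\int[mu]_x (W x * W x))%E => [n| |] // n0 _.
case: (\int[mu]_x (F x * F x))%E => [A| |] // A0; last by move=> _; rewrite leey.
rewrite -!EFinM -EFinD !lee_fin; lra.
Qed.

(** The indicator makes every iterate vanish off [S] and keeps the factor below [K2^-1] everywhere,
    although [a] has a lower bound on [S] only. *)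
Let inv_a x : R := \1_S x / fine (a x).

Let a_fin x : a x \is a fin_num.
Proof. by rewrite ge0_fin_numE//; apply: le_lt_trans (row_le x) _; rewrite ltry. Qed.

(** Drop the two nonnegative operator terms from [dissip]. *)
Let K2_le_a x : S x -> K2 <= fine (a x).
Proof.
move=> /dissip; rewrite -(fineK (a_fin x)) -EFinM => h.
suff : ((2 * K2)%:E <= (2 * fine (a x))%:E)%E by rewrite lee_fin ler_pM2l.
by apply: le_trans h; rewrite leeDr// adde_ge0 ?kop_ge0 ?kop_tr_ge0.
Qed.

Let inv_a_ge0 x : 0 <= inv_a x.
Proof. by rewrite /inv_a divr_ge0// fine_ge0. Qed.

Let inv_a_le x : inv_a x <= K2^-1.
Proof.
rewrite /inv_a indicE; have [Sx|Sx] := pselect (S x); last first.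
  by rewrite memNset// mul0r invr_ge0 ltW.
rewrite mem_set// mul1r lef_pV2 ?posrE// ?K2_le_a//.
by apply: lt_le_trans K20 _; rewrite K2_le_a.
Qed.

Let minv_a : measurable_fun setT inv_a.
Proof.
apply: measurable_funM; first exact: measurable_indic.
by apply: measurable_funV; exact: (measurableT_comp (fine_measurable measurableT) ma).
Qed.

Let mulKa x y : S x -> (a x * ((inv_a x)%:E * y) = y)%E.
Proof.
move=> Sx; rewrite muleA -[a x]fineK// -EFinM /inv_a indicE mem_set// mul1r divff ?mul1e//.
by rewrite gt_eqF// (lt_le_trans K20)// K2_le_a.
Qed.

Let inv_a0 x : ~ S x -> inv_a x = 0.
Proof. by move=> Sx; rewrite /inv_a indicE memNset// mul0r. Qed.

(** The limit [U] is left extended-valued: the equation then holds at every point of [S], and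
    possible infinite values on a null set are dealt with later. *)
Theorem ge0_solution (F : T -> \bar R) :
  measurable_fun setT F -> (forall x, 0 <= F x)%E ->
  (\int[mu]_x (F x * F x) < +oo)%E ->
  exists U : T -> \bar R,
   [/\ measurable_fun setT U, (forall x, 0 <= U x)%E,
       (forall x, ~ S x -> U x = 0)%E,
       ((K2 * K2)%:E * \int[mu]_x (U x * U x) <= \int[mu]_x (F x * F x))%E &
       forall x, S x -> (a x * U x = F x + K U x)%E].
Proof.
move=> mF F0 Ffin.
have K220 : 0 < K2 * K2 by rewrite mulr_gt0.
have mFF : measurable_fun setT (fun x => F x * F x)%E by exact: emeasurable_funM.
have FF0 x : (0 <= F x * F x)%E by rewrite mule_ge0.
pose step (w : T -> \bar R) x := ((inv_a x)%:E * (F x + K w x))%E.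
pose u := fix u k := if k is k'.+1 then step (u k') else cst 0%E.
have uP k : measurable_fun setT (u k) /\ forall x, (0 <= u k x)%E.
  elim: k => [|k [mu_ u0]]; first by split => //; exact: measurable_cst.
  split=> [|x /=]; last by rewrite mule_ge0 ?lee_fin// adde_ge0// kop_ge0.
  apply: emeasurable_funM; first exact/measurable_EFinP.
  by apply: emeasurable_funD => //; exact: measurable_kop.
have mu_ k : measurable_fun setT (u k) by have [] := uP k.
have u0 k x : (0 <= u k x)%E by have [] := uP k.
have uu0 k x : (0 <= u k x * u k x)%E by rewrite mule_ge0.
have muu k : measurable_fun setT (fun x => u k x * u k x)%E by exact: emeasurable_funM.
have uS k x : (u k x <= u k.+1 x)%E.
  elim: k x => [|k IH] x; first exact: (u0 1%N).
  rewrite /= /step lee_wpmul2l ?lee_fin// leeD2l//; apply: kop_mono => //.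
  exact: (mu_ k.+1).
have u_off k x : ~ S x -> u k x = 0%E.
  by case: k => [//|k] Sx; rewrite /= /step inv_a0// mul0e.
have uE k x : S x -> (a x * u k.+1 x = F x + K (u k) x)%E.
  by move=> Sx; rewrite /= /step mulKa.
(* Induction through Schur's test. This is not uniform in [k]; the uniform bound [ubound] needs it
   as an input. *)
have ufin k : (\int[mu]_x (u k x * u k x) < +oo)%E.
  elim: k => [|k IH].
    by rewrite (eq_integral (cst 0%E)) ?integral0 ?ltry// => x _; rewrite /= mul0e.
  have mKu : measurable_fun setT (K (u k)) by exact: measurable_kop.
  have KuKu0 x : (0 <= K (u k) x * K (u k) x)%E by rewrite mule_ge0 ?kop_ge0.
  have mKuKu : measurable_fun setT (fun x => K (u k) x * K (u k) x)%E.
    exact: emeasurable_funM.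
  have V2 : 0 <= 2 * (K2^-1 * K2^-1) by rewrite !mulr_ge0 ?invr_ge0 ?(ltW K20).
  apply: (@le_lt_trans _ _ ((2 * (K2^-1 * K2^-1))%:E *
      (\int[mu]_x (F x * F x) + \int[mu]_x (K (u k) x * K (u k) x)))%E).
    rewrite -ge0_integralD// -ge0_integralZl ?lee_fin//; last 2 first.
    - exact: emeasurable_funD.
    - by move=> x _; rewrite adde_ge0.
    apply: ge0_le_integralT.
    - exact: (muu k.+1).
    - by apply: measurable_funeM; exact: emeasurable_funD.
    - exact: (uu0 k.+1).
    move=> x; rewrite /= /step muleACA -EFinM.
    apply: (@le_trans _ _ ((K2^-1 * K2^-1)%:E * (2%:E * (F x * F x + K (u k) x * K (u k) x)))%E).
      apply: lee_pmul.
      - by rewrite lee_fin mulr_ge0.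
      - by rewrite mule_ge0// adde_ge0 ?kop_ge0.
      - by rewrite lee_fin ler_pM.
      - by rewrite ge0_sqreD_le// kop_ge0.
    by rewrite muleA -EFinM (mulrC 2).
  rewrite lte_mul_pinfty ?lee_fin// lte_add_pinfty//.
  apply: le_lt_trans (schur (mu_ k) (u0 k)) _.
  by rewrite lte_mul_pinfty ?lee_fin ?mulr_ge0 ?(ltW M0) ?(ltW K10).
have ubound k : ((K2 * K2)%:E * \int[mu]_x (u k x * u k x) <= \int[mu]_x (F x * F x))%E.
  apply: subsolution_bound => //; first exact: u_off.
  apply: aeW => x Sx; rewrite -uE//; exact: lee_wpmul2l.
pose U x := limn (u ^~ x).
have uU x : u k x @[k --> \oo] --> U x.
  by apply: ereal_nondecreasing_is_cvgn; exact/nondecreasing_seqP.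
have U0 x : (0 <= U x)%E by apply: lime_ge; [exact: uU|by apply: nearW => k].
exists U; split => //.
- by apply: (emeasurable_fun_cvg u U) => // x _; exact: uU.
- move=> x Sx; rewrite /U (_ : u ^~ x = cst 0%E) ?lim_cst//.
  by apply/funext => k; rewrite u_off.
- have cU : (\int[mu]_x (u k x * u k x))%E @[k --> \oo] --> (\int[mu]_x (U x * U x))%E.
    apply: cvg_integral_nondecreasing => // [k x|x]; last exact: cvg_sqre.
    exact: lee_pmul.
  have cKU := @cvgeZl _ _ _ _ _ (K2 * K2)%:E isT cU.
  rewrite -(cvg_lim _ cKU)//; apply: lime_le; last exact: nearW.
  by apply/cvg_ex; eexists; exact: cKU.
- move=> x Sx.
  have c1 : (a x * u k.+1 x)%E @[k --> \oo] --> (a x * U x)%E.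
    (* The recursion pairs [u k.+1] on the left with [u k] on the right, hence the shift of index in
       the limit. *)
    by apply: cvgeZl => //; have := uU x; rewrite -(cvg_shiftS (u ^~ x)).
  have c2 : (F x + K (u k) x)%E @[k --> \oo] --> (F x + K U x)%E.
    apply: cvgeD => //; last exact: cvg_kop.
      by rewrite ge0_adde_def ?inE ?kop_ge0.
    exact: cvg_cst.
  have E : (fun k => a x * u k.+1 x)%E = (fun k => F x + K (u k) x)%E.
    by apply/funext => k; rewrite uE.
  by rewrite E in c1; rewrite -(cvg_lim _ c1)// -(cvg_lim _ c2).
Qed.
End dissipative_kernel.

(** * Square-integrable functions *)

Section square_integrable.
Context d (T : measurableType d) (R : realType).
Variable mu : {measure set T -> \bar R}.

Definition sqint (u : T -> R) := (\int[mu]_x ((u x) ^+ 2)%:E < +oo)%E.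

Lemma measurable_sqr (u : T -> R) :
  measurable_fun setT u -> measurable_fun setT (fun x => ((u x) ^+ 2)%:E).
Proof. by move=> mu_; apply/measurable_EFinP; exact: measurable_funX. Qed.

Lemma sqint_le (u v : T -> R) :
  measurable_fun setT u -> measurable_fun setT v ->
  (forall x, `|u x| <= `|v x|) -> sqint v -> sqint u.
Proof.
move=> mu_ mv uv; apply: le_lt_trans; apply: ge0_le_integralT.
- exact: measurable_sqr.
- exact: measurable_sqr.
- by move=> x; rewrite lee_fin sqr_ge0.
- by move=> x; rewrite lee_fin -real_normK ?num_real// -[leRHS]real_normK ?num_real// lerXn2r ?nnegrE.
Qed.

Lemma sqint_le2 (u v w : T -> R) (c : R) :
  measurable_fun setT u -> measurable_fun setT v -> measurable_fun setT w ->
  0 <= c -> (forall x, u x ^+ 2 <= c * (v x ^+ 2 + w x ^+ 2)) ->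
  sqint v -> sqint w -> sqint u.
Proof.
move=> mu_ mv mw c0 uvw iv iw.
apply: (@le_lt_trans _ _ (c%:E * (\int[mu]_x ((v x) ^+ 2)%:E + \int[mu]_x ((w x) ^+ 2)%:E))%E).
  rewrite -ge0_integralD//; last 4 first.
  - by move=> x _; rewrite lee_fin sqr_ge0.
  - exact: measurable_sqr.
  - by move=> x _; rewrite lee_fin sqr_ge0.
  - exact: measurable_sqr.
  rewrite -ge0_integralZl ?lee_fin//; last 2 first.
  - by apply: emeasurable_funD; exact: measurable_sqr.
  - by move=> x _; rewrite adde_ge0// lee_fin sqr_ge0.
  apply: ge0_le_integralT.
  - exact: measurable_sqr.
  - by apply: measurable_funeM; apply: emeasurable_funD; exact: measurable_sqr.
  - by move=> x; rewrite lee_fin sqr_ge0.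
  - by move=> x; rewrite lee_fin.
by rewrite lte_mul_pinfty ?lee_fin// lte_add_pinfty.
Qed.

Lemma sqintD (u v : T -> R) :
  measurable_fun setT u -> measurable_fun setT v ->
  sqint u -> sqint v -> sqint (u \+ v).
Proof.
move=> mu_ mv; apply: (@sqint_le2 _ _ _ 2) => //; first exact: measurable_funD.
by move=> x /=; have := sqr_ge0 (u x - v x); nra.
Qed.

Lemma sqintN (u : T -> R) : sqint u -> sqint (\- u).
Proof.
rewrite /sqint; congr (_ < _)%E; apply: eq_integral => x _; by rewrite /= sqrrN.
Qed.

Lemma sqintB (u v : T -> R) :
  measurable_fun setT u -> measurable_fun setT v ->
  sqint u -> sqint v -> sqint (u \- v).
Proof.
move=> mu_ mv iu iv; apply: sqintD => //; last exact: sqintN.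
exact: measurableT_comp.
Qed.

(** From [|u v| <= u^2 + v^2]; the missing factor one half is irrelevant for finiteness. *)
Lemma sqintM_integrable (u v : T -> R) :
  measurable_fun setT u -> measurable_fun setT v ->
  sqint u -> sqint v -> mu.-integrable setT (fun x => (u x * v x)%:E).
Proof.
move=> mu_ mv iu iv; apply/integrableP; split.
  by apply/measurable_EFinP; exact: measurable_funM.
apply: (@le_lt_trans _ _ (\int[mu]_x (((u x) ^+ 2)%:E + ((v x) ^+ 2)%:E))%E).
  apply: ge0_le_integralT.
  - by apply: measurableT_comp => //; apply/measurable_EFinP; exact: measurable_funM.
  - by apply: emeasurable_funD; exact: measurable_sqr.
  - by [].
  - move=> x; rewrite abse_EFin -EFinD lee_fin ler_norml.
    have h1 := sqr_ge0 (u x - v x); have h2 := sqr_ge0 (u x + v x).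
    have h3 := sqr_ge0 (u x); have h4 := sqr_ge0 (v x).
    by apply/andP; split; nra.
rewrite ge0_integralD//; last 4 first.
- by move=> x _; rewrite lee_fin sqr_ge0.
- exact: measurable_sqr.
- by move=> x _; rewrite lee_fin sqr_ge0.
- exact: measurable_sqr.
by rewrite lte_add_pinfty.
Qed.

Lemma sqint_ae_eq0 (u : T -> R) : measurable_fun setT u ->
  (\int[mu]_x ((u x) ^+ 2)%:E <= 0)%E -> {ae mu, forall x, u x = 0}.
Proof.
move=> mu_ u0.
have : (\int[mu]_x `|((u x) ^+ 2)%:E| = 0)%E.
  apply/eqP; rewrite eq_le integral_ge0// andbT; apply: le_trans u0.
  by under eq_integral => x _ do rewrite abse_EFin ger0_norm ?sqr_ge0//.
move/(ae_eq_integral_abs mu measurableT (measurable_sqr mu_)).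
apply: filterS => x /(_ I) /= [] /eqP; rewrite sqrf_eq0 => /eqP//.
Qed.

Lemma sqr_integral_lty_ae_fin (U : T -> \bar R) : measurable_fun setT U ->
  (forall x, 0 <= U x)%E -> (\int[mu]_x (U x * U x) < +oo)%E ->
  {ae mu, forall x, U x \is a fin_num}.
Proof.
move=> mU U0 Ufin.
have : mu.-integrable setT (fun x => U x * U x)%E.
  apply/integrableP; split; first exact: emeasurable_funM.
  by under eq_integral => x _ do rewrite gee0_abs ?mule_ge0//.
move/(integrable_ae measurableT); apply: filterS => x /(_ I).
have := U0 x; by case: (U x) => [r| |]//=; rewrite mulyy.
Qed.

End square_integrable.

(** * The weak equation *)

Section weak_form.
Context d (T : measurableType d) (R : realType).
Variable mu : {sigma_finite_measure set T -> \bar R}.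
Variable G : T -> T -> R.
Hypothesis G0 : forall x y, 0 <= G x y.
Hypothesis mG : measurable_fun setT (fun z : T * T => G z.1 z.2).
Variables (S : set T) (M K1 K2 : R).
Hypotheses (mS : measurable S) (M0 : 0 < M) (K10 : 0 < K1) (K20 : 0 < K2).

Local Notation K := (kop mu G).
Local Notation a := (kop mu G (cst 1%E)).
Local Notation at_ := (kop_tr mu G (cst 1%E)).
Local Notation chiS := (fun x : T => (\1_S x : R)%:E).
Local Notation Kr p := (fun x => fine (kop mu G (EFin \o p) x)).
Local Notation ar := (fun x => fine (kop mu G (cst 1%E) x)).

Hypothesis row_le : forall x, (a x <= M%:E)%E.
Hypothesis col_le : forall y, (at_ y <= K1%:E)%E.
Hypothesis dissip : forall x, S x ->
  (K chiS x + kop_tr mu G chiS x + (2 * K2)%:E <= 2%:E * a x)%E.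

Definition weak_form (u v : T -> R) : \bar R :=
  (\int[mu]_x \int[mu]_y (((u x - u y) * v x * G x y)%R)%:E)%E.

Let a_ge0 x : (0 <= a x)%E.
Proof. exact: kop_ge0. Qed.

Let m1 : measurable_fun setT (cst 1%E : T -> \bar R).
Proof. exact: measurable_cst. Qed.

Let a_fin x : a x \is a fin_num.
Proof. by rewrite ge0_fin_numE//; apply: le_lt_trans (row_le x) _; rewrite ltry. Qed.

Let mar : measurable_fun setT ar.
Proof.
apply: (measurableT_comp (fine_measurable measurableT)); exact: measurable_kop.
Qed.

(** A signed integral is by definition the difference of the integrals of the positive and negative
    parts. Tonelli applies to each, so the inner integral is measurable without any
    integrability. *)
Lemma measurable_weak_integrand (u v : T -> R) :
  measurable_fun setT u -> measurable_fun setT v ->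
  measurable_fun setT
    (fun x => \int[mu]_y (((u x - u y) * v x * G x y)%R)%:E)%E.
Proof.
move=> mu_ mv.
pose phi (z : T * T) : \bar R := (((u z.1 - u z.2) * v z.1 * G z.1 z.2)%R)%:E.
have mphi : measurable_fun setT phi.
  apply/measurable_EFinP; apply: measurable_funM => //; apply: measurable_funM.
    by apply: measurable_funB; exact: measurableT_comp.
  exact: measurableT_comp.
have -> : (fun x => \int[mu]_y (((u x - u y) * v x * G x y)%R)%:E)%E =
   (fun x => \int[mu]_y (phi^\+ (x, y)) - \int[mu]_y (phi^\- (x, y)))%E.
  apply/funext => x; rewrite [LHS]integralE.
  by congr (_ - _)%E; apply: eq_integral => y _; rewrite ?funeposE ?funenegE.
apply: emeasurable_funB.
- apply: (@measurable_fun_fubini_tonelli_F _ _ _ _ _ mu phi^\+%E) => //.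
  exact: measurable_funepos.
- apply: (@measurable_fun_fubini_tonelli_F _ _ _ _ _ mu phi^\-%E) => //.
  exact: measurable_funeneg.
Qed.

(** Finiteness of [K p] and [K q] at the point [x] makes each piece of the integrand integrable in
    [y], so that linearity of the integral is available. *)
Lemma inner_integral (u p q : T -> R) (c : R) (x : T) :
  measurable_fun setT u -> measurable_fun setT p -> measurable_fun setT q ->
  (forall y, 0 <= p y) -> (forall y, 0 <= q y) ->
  {ae mu, forall y, u y = p y - q y} ->
  K (EFin \o p) x \is a fin_num -> K (EFin \o q) x \is a fin_num ->
  (\int[mu]_y (((u x - u y) * c * G x y)%R)%:E =
   (c * (u x * ar x - (Kr p x - Kr q x)))%:E)%E.
Proof.
move=> mu_ mp mq p0 q0 upq Kpf Kqf.
have mGx := measurable_Gx mG x.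
have iGM (w : T -> R) : measurable_fun setT w -> (forall y, 0 <= w y) ->
    K (EFin \o w) x \is a fin_num ->
    mu.-integrable setT (fun y => (G x y * w y)%:E).
  move=> mw w0 Kw; apply/integrableP; split.
    by apply/measurable_EFinP; exact: measurable_funM.
  under eq_integral => y _ do rewrite abse_EFin ger0_norm ?mulr_ge0//.
  by rewrite -ge0_fin_numE// integral_ge0// => y _; rewrite lee_fin mulr_ge0.
have iG := iGM (cst 1) (measurable_cst _) (fun=> ler01) (a_fin x).
have ip := iGM p mp p0 Kpf; have iq := iGM q mq q0 Kqf.
transitivity (\int[mu]_y (c%:E * ((u x)%:E * (G x y * 1)%:E -
    ((G x y * p y)%:E - (G x y * q y)%:E))))%E.
  apply: ae_eq_integral => //.
  - apply/measurable_EFinP; apply: measurable_funM => //.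
    by apply: measurable_funM => //; exact: measurable_funB.
  - apply: measurable_funeM; apply: emeasurable_funB.
      by apply: measurable_funeM; apply/measurable_EFinP; exact: measurable_funM.
    by apply: emeasurable_funB; apply/measurable_EFinP; exact: measurable_funM.
  apply: filterS upq => y uy _.
  rewrite uy -[RHS]/((c * (u x * (G x y * 1) - (G x y * p y - G x y * q y)))%:E).
  by congr (_%:E); ring.
have iuG : mu.-integrable setT (fun y => (u x)%:E * (G x y * 1)%:E)%E.
  exact: integrableZl.
have ipq : mu.-integrable setT (fun y => (G x y * p y)%:E - (G x y * q y)%:E)%E.
  exact: integrableB.
rewrite integralZl//; last exact: integrableB.
rewrite integralB// integralB// integralZl//.
have KE (w : T -> R) : (\int[mu]_y (G x y * w y)%:E = K (EFin \o w) x)%E.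
  by apply: eq_integral => y _; rewrite EFinM.
rewrite (KE (cst 1)) !KE -(fineK (a_fin x)) -(fineK Kpf) -(fineK Kqf).
by [].
Qed.

Section nonneg.
Variable p : T -> R.
Hypotheses (mp : measurable_fun setT p) (p0 : forall x, 0 <= p x) (ip : sqint mu p).

Let mEp : measurable_fun setT (EFin \o p).
Proof. exact/measurable_EFinP. Qed.

Let Ep0 x : (0 <= (EFin \o p) x)%E.
Proof. by rewrite lee_fin. Qed.

Let KpKp : (\int[mu]_x (K (EFin \o p) x * K (EFin \o p) x) < +oo)%E.
Proof.
apply: le_lt_trans (schur G0 mG M0 K10 row_le col_le mEp Ep0) _.
by rewrite lte_mul_pinfty ?lee_fin ?mulr_ge0 ?(ltW M0) ?(ltW K10).
Qed.

(** Schur's test makes [(K p)^2] integrable, hence finite almost everywhere. *)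
Lemma kop_ae_fin : {ae mu, forall x, K (EFin \o p) x \is a fin_num}.
Proof.
apply: sqr_integral_lty_ae_fin => //; first exact: measurable_kop.
by move=> x; exact: kop_ge0.
Qed.

Lemma measurable_fine_kop : measurable_fun setT (Kr p).
Proof. by apply: (measurableT_comp (fine_measurable measurableT)); exact: measurable_kop. Qed.

Lemma sqint_fine_kop : sqint mu (Kr p).
Proof.
apply: le_lt_trans KpKp; apply: ge0_le_integralT.
- apply: measurable_sqr; exact: measurable_fine_kop.
- by apply: emeasurable_funM; exact: measurable_kop.
- by move=> x; rewrite lee_fin sqr_ge0.
- move=> x; have := kop_ge0 mu G0 Ep0 x.
  by case: (K _ x) => [r| |] // r0; rewrite /= ?expr2 ?mulyy ?mul0r// leey.
Qed.

End nonneg.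

(** Rewrites the double integral as [v] tested against the residual [a u - K u], where [K u] means
    [K p - K q]. The two integrands agree almost everywhere, so no integrability of [v] enters. *)
Lemma weak_formE (u p q v : T -> R) :
  measurable_fun setT u -> measurable_fun setT v ->
  measurable_fun setT p -> measurable_fun setT q ->
  (forall y, 0 <= p y) -> (forall y, 0 <= q y) ->
  sqint mu p -> sqint mu q ->
  {ae mu, forall y, u y = p y - q y} ->
  weak_form u v = (\int[mu]_x (v x * (u x * ar x - (Kr p x - Kr q x)))%:E)%E.
Proof.
move=> mu_ mv mp mq p0 q0 ip iq upq; apply: ae_eq_integral => //.
- exact: measurable_weak_integrand.
- apply/measurable_EFinP; apply: measurable_funM => //; apply: measurable_funB.
    exact: measurable_funM.
  by apply: measurable_funB; exact: measurable_fine_kop.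
apply: filterS2 (kop_ae_fin mp p0 ip) (kop_ae_fin mq q0 iq) => x Kp Kq _.
exact: inner_integral.
Qed.

(** Splitting [f] costs no constant: [(p - q)^2 <= p^2 + q^2] because [p q >= 0], while the squares
    of the positive and negative parts of [f] add up exactly to [f^2]. *)
Lemma weak_solution_exists (f : T -> R) : measurable_fun setT f -> sqint mu f ->
  exists u : T -> R,
   [/\ measurable_fun setT u, (forall x, ~ S x -> u x = 0),
       ((K2 * K2)%:E * \int[mu]_x ((u x) ^+ 2)%:E <= \int[mu]_x ((f x) ^+ 2)%:E)%E &
       forall v : T -> R, measurable_fun setT v -> {ae mu, forall x, ~ S x -> v x = 0} ->
         weak_form u v = (\int[mu]_x (f x * v x)%:E)%E].
Proof.
move=> mf fi.
have half (g : T -> R) : measurable_fun setT g -> (forall x, 0 <= g x) -> sqint mu g ->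
  exists p : T -> R,
    [/\ measurable_fun setT p, (forall x, 0 <= p x), (forall x, ~ S x -> p x = 0),
      ((K2 * K2)%:E * \int[mu]_x ((p x) ^+ 2)%:E <= \int[mu]_x ((g x) ^+ 2)%:E)%E &
      {ae mu, forall x, S x -> p x * ar x = g x + Kr p x}].
  move=> mg g0 gi.
  have [U [mU U0 US Ub UE]] := ge0_solution G0 mG mS M0 K10 K20 row_le col_le dissip
    (iffRL (measurable_EFinP _ _) mg) (fun x => g0 x : (0 <= (EFin \o g) x)%E) gi.
  have K220 : 0 < K2 * K2 by rewrite mulr_gt0.
  have Ufin : {ae mu, forall x, U x \is a fin_num}.
    apply: sqr_integral_lty_ae_fin => //.
    have := le_lt_trans Ub gi.
    have : (0 <= \int[mu]_x (U x * U x))%E by apply: integral_ge0 => x _; rewrite mule_ge0.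
    case: (\int[mu]_x (U x * U x))%E => [r| |] // _; first by move=> _; rewrite ltry.
    by rewrite gt0_muley ?lte_fin.
  (* [fine] replaces the value [+oo] by [0], a change on a null set only, which [K] does not see. *)
  pose p x := fine (U x).
  have mp : measurable_fun setT p by exact: (measurableT_comp (fine_measurable measurableT)).
  have p0 x : 0 <= p x by rewrite fine_ge0.
  have pU x : ((p x)%:E <= U x)%E.
    by have := U0 x; rewrite /p; case: (U x) => //= _; rewrite leey.
  have KpU x : K (EFin \o p) x = K U x.
    apply: ge0_ae_eq_integral => //.
    - by apply: measurable_GMx => //; exact/measurable_EFinP.
    - exact: measurable_GMx.
    - by move=> y _; rewrite mule_ge0 ?lee_fin.
    - by move=> y _; rewrite mule_ge0 ?lee_fin.
    - by apply: filterS Ufin => y Uy _ /=; rewrite fineK.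
  exists p; split => //.
  - by move=> x Sx; rewrite /p US.
  - apply: le_trans Ub; apply: lee_wpmul2l; first by rewrite lee_fin ltW.
    apply: ge0_le_integralT.
    - exact: measurable_sqr.
    - exact: emeasurable_funM.
    - by move=> x; rewrite lee_fin sqr_ge0.
    - by move=> x; rewrite expr2 EFinM lee_pmul// lee_fin.
  (* Where [U x] is finite the left side [a x * U x] is finite, and the equation itself rules out
     [K U x = +oo]. *)
  - apply: filterS Ufin => x Ux Sx; have := UE x Sx.
    rewrite KpU -{1}(fineK (a_fin x)) -{1}(fineK Ux) -EFinM /=.
    have := kop_ge0 mu G0 U0 x.
    by case: (K U x) => [r| |] // _ [] <-; rewrite mulrC.
have mfp := measurable_funrpos mf; have mfn := measurable_funrneg mf.
have fsplit x : f x ^+ 2 = f^\+ x ^+ 2 + f^\- x ^+ 2 /\ f x = f^\+ x - f^\- x.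
  rewrite /funrpos /funrneg; case: (leP (f x) 0) => h.
    by rewrite max_l ?oppr_ge0// expr0n/= add0r sqrrN sub0r opprK.
  by rewrite max_r ?oppr_le0 ?(ltW h)// expr0n/= addr0 subr0.
have fip : sqint mu f^\+.
  apply: sqint_le fi => // x; rewrite -[leLHS]ger0_norm ?normr_ge0// .
  by rewrite /funrpos normr_id; case: (leP (f x) 0) => h; rewrite ?normr0.
have fin : sqint mu f^\-.
  apply: sqint_le fi => // x.
  by rewrite /funrneg; case: (leP (- f x) 0) => h; rewrite ?normr0 ?normrN.
have [p [mp p0 pS pb pE]] := half _ mfp (funrpos_ge0 f) fip.
have [q [mq q0 qS qb qE]] := half _ mfn (funrneg_ge0 f) fin.
have K220 : 0 < K2 * K2 by rewrite mulr_gt0.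
have sq (g w : T -> R) : sqint mu g ->
    ((K2 * K2)%:E * \int[mu]_x ((w x) ^+ 2)%:E <= \int[mu]_x ((g x) ^+ 2)%:E)%E -> sqint mu w.
  move=> gi b; have := le_lt_trans b gi; rewrite /sqint.
  have : (0 <= \int[mu]_x ((w x) ^+ 2)%:E)%E by apply: integral_ge0 => x _; rewrite lee_fin sqr_ge0.
  case: (\int[mu]_x ((w x) ^+ 2)%:E)%E => [r| |] // _; first by move=> _; rewrite ltry.
  by rewrite gt0_muley ?lte_fin.
have ip := sq _ _ fip pb; have iq := sq _ _ fin qb.
exists (p \- q); split.
- exact: measurable_funB.
- by move=> x Sx; rewrite /= pS// qS// subrr.
- have -> : (\int[mu]_x ((f x) ^+ 2)%:E =
     \int[mu]_x ((f^\+ x) ^+ 2)%:E + \int[mu]_x ((f^\- x) ^+ 2)%:E)%E.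
    rewrite -ge0_integralD//; last 4 first.
    - by move=> x _; rewrite lee_fin sqr_ge0.
    - exact: measurable_sqr.
    - by move=> x _; rewrite lee_fin sqr_ge0.
    - exact: measurable_sqr.
    by apply: eq_integral => x _; rewrite -EFinD (fsplit x).1.
  apply: le_trans (leeD pb qb).
  rewrite -ge0_muleDr; [|by apply: integral_ge0 => x _; rewrite lee_fin sqr_ge0..].
  apply: lee_wpmul2l; first by rewrite lee_fin ltW.
  rewrite -ge0_integralD//; last 4 first.
  - by move=> x _; rewrite lee_fin sqr_ge0.
  - exact: measurable_sqr.
  - by move=> x _; rewrite lee_fin sqr_ge0.
  - exact: measurable_sqr.
  apply: ge0_le_integralT.
  - by apply: measurable_sqr; exact: measurable_funB.
  - by apply: emeasurable_funD; exact: measurable_sqr.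
  - by move=> x; rewrite lee_fin sqr_ge0.
  - by move=> x; rewrite -EFinD lee_fin /=; have := mulr_ge0 (p0 x) (q0 x); nra.
- move=> v mv vS.
  rewrite (@weak_formE _ p q)//; [|exact: measurable_funB|exact: aeW].
  apply: ae_eq_integral => //.
  + apply/measurable_EFinP; apply: measurable_funM => //; apply: measurable_funB.
      by apply: measurable_funM => //; exact: measurable_funB.
    by apply: measurable_funB; exact: measurable_fine_kop.
  + by apply/measurable_EFinP; exact: measurable_funM.
  apply: filterS3 vS pE qE => x vx px qx _.
  have [Sx|Sx] := pselect (S x); last by rewrite vx// mul0r mulr0.
  congr (_%:E); rewrite mulrBl px// qx// (fsplit x).2; ring.
Qed.

Section weak_solution.
Variables (f u p q : T -> R).
Hypotheses (mf : measurable_fun setT f) (fi : sqint mu f).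
Hypotheses (mu_ : measurable_fun setT u) (ui : sqint mu u).
Hypotheses (mp : measurable_fun setT p) (mq : measurable_fun setT q).
Hypotheses (p0 : forall x, 0 <= p x) (q0 : forall x, 0 <= q x).
Hypotheses (ip : sqint mu p) (iq : sqint mu q).
Hypothesis upq : {ae mu, forall x, u x = p x - q x}.
Hypothesis weak : forall v : T -> R, measurable_fun setT v -> sqint mu v ->
  {ae mu, forall x, ~ S x -> v x = 0} ->
  weak_form u v = (\int[mu]_x (f x * v x)%:E)%E.

(* The equation is tested against its own residual restricted to [S]. *)
Lemma weak_solution_strong :
  {ae mu, forall x, S x -> u x * ar x - (Kr p x - Kr q x) = f x}.
Proof.
pose h x := u x * ar x - (Kr p x - Kr q x).
have mKp := measurable_fine_kop mp p0; have mKq := measurable_fine_kop mq q0.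
have iKp := sqint_fine_kop mp p0 ip; have iKq := sqint_fine_kop mq q0 iq.
have mua : measurable_fun setT (fun x => u x * ar x) by exact: measurable_funM.
have mKpq := measurable_funB mKp mKq.
have mh : measurable_fun setT h by exact: measurable_funB.
have ih : sqint mu h.
  apply: (sqintB mua mKpq); last exact: sqintB.
  (* The row bound gives [0 <= a <= M], hence [(u a)^2 <= M^2 u^2]. *)
  apply: (@sqint_le2 _ _ _ mu _ u u (M ^+ 2)) => //; first exact: sqr_ge0.
  move=> x; rewrite exprMn mulrC.
  have a2 : ar x ^+ 2 <= M ^+ 2.
    rewrite lerXn2r ?nnegrE ?fine_ge0 ?(ltW M0)//.
    by rewrite -lee_fin fineK.
  have u2 := sqr_ge0 (u x).
  by apply: ler_pM; rewrite ?sqr_ge0 ?lerDl.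
pose r x := (\1_S x : R) * (h x - f x).
have mhf := measurable_funB mh mf.
have mr : measurable_fun setT r by apply: measurable_funM => //; exact: measurable_indic.
have ir : sqint mu r.
  apply: (sqint_le mr mhf _ (sqintB mh mf ih fi)) => x.
  by rewrite /r normrM ler_piMl// indicE ger0_norm// lern1 leq_b1.
have rS x : S x -> r x = h x - f x by move=> Sx; rewrite /r indicE mem_set// mul1r.
have r_off x : ~ S x -> r x = 0 by move=> Sx; rewrite /r indicE memNset// mul0r.
have := weak mr ir (aeW mu r_off).
rewrite (@weak_formE u p q r)//.
have ifr := sqintM_integrable mf mr fi ir.
have irr := sqintM_integrable mr mr ir ir.
have -> : (\int[mu]_x (r x * (u x * ar x - (Kr p x - Kr q x)))%:E =
    \int[mu]_x (r x * r x)%:E + \int[mu]_x (f x * r x)%:E)%E.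
  rewrite -integralD//; apply: eq_integral => x _; rewrite -EFinD; congr (_%:E).
  have [Sx|Sx] := pselect (S x); last by rewrite r_off// !mul0r mulr0 addr0.
  by rewrite rS// /h; ring.
have ffin : (\int[mu]_x (f x * r x)%:E)%E \is a fin_num by exact: integrable_fin_num.
(* The weak equation has become [\int r^2 + \int f r = \int f r], and the repeated term is
   finite. *)
move=> rr0; have {rr0} : (\int[mu]_x (r x * r x)%:E <= 0)%E.
  by rewrite -(leeD2rE _ _ ffin) rr0 add0e.
move=> /(sqint_ae_eq0 mr); apply: filterS => x rx0 Sx.
by move: rx0; rewrite rS// => /eqP; rewrite subr_eq0 => /eqP.
Qed.

End weak_solution.

Let le_kop_ae (v w : T -> \bar R) x :
  measurable_fun setT v -> measurable_fun setT w ->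
  (forall x, 0 <= v x)%E -> (forall x, 0 <= w x)%E ->
  {ae mu, forall x, (v x <= w x)%E} -> (K v x <= K w x)%E.
Proof.
move=> mv mw v0 w0 vw; apply: ae_ge0_le_integral => //.
- by move=> y _; rewrite mule_ge0 ?lee_fin.
- exact: measurable_GMx.
- by move=> y _; rewrite mule_ge0 ?lee_fin.
- exact: measurable_GMx.
- by apply: filterS vw => y vwy _; rewrite lee_wpmul2l ?lee_fin.
Qed.

Let kopD (v w : T -> \bar R) x :
  measurable_fun setT v -> measurable_fun setT w ->
  (forall x, 0 <= v x)%E -> (forall x, 0 <= w x)%E ->
  (K (fun y => v y + w y) x = K v x + K w x)%E.
Proof.
move=> mv mw v0 w0; rewrite /kop -ge0_integralD//; last 4 first.
- by move=> y _; rewrite mule_ge0 ?lee_fin.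
- exact: measurable_GMx.
- by move=> y _; rewrite mule_ge0 ?lee_fin.
- exact: measurable_GMx.
by apply: eq_integral => y _; rewrite ge0_muleDr.
Qed.

(** Subtracting the two pointwise equations gives [a (u1 - u2) = K (u1 - u2)] on [S], hence
    [a |u1 - u2| <= K |u1 - u2|]: the data term is zero and the energy bound forces the modulus to
    vanish. *)
Lemma weak_solution_unique (f u1 u2 : T -> R) :
  measurable_fun setT f -> sqint mu f ->
  measurable_fun setT u1 -> sqint mu u1 -> {ae mu, forall x, ~ S x -> u1 x = 0} ->
  measurable_fun setT u2 -> sqint mu u2 -> {ae mu, forall x, ~ S x -> u2 x = 0} ->
  (forall v : T -> R, measurable_fun setT v -> sqint mu v ->
    {ae mu, forall x, ~ S x -> v x = 0} ->
    weak_form u1 v = (\int[mu]_x (f x * v x)%:E)%E) ->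
  (forall v : T -> R, measurable_fun setT v -> sqint mu v ->
    {ae mu, forall x, ~ S x -> v x = 0} ->
    weak_form u2 v = (\int[mu]_x (f x * v x)%:E)%E) ->
  {ae mu, forall x, u1 x = u2 x}.
Proof.
move=> mf fi m_u1 i_u1 z_u1 m_u2 i_u2 z_u2 weak1 weak2.
have split_ (u : T -> R) x : u x = u^\+ x - u^\- x.
  rewrite /funrpos /funrneg; case: (leP (u x) 0) => h.
    by rewrite max_l ?oppr_ge0// sub0r opprK.
  by rewrite max_r ?oppr_le0 ?(ltW h)// subr0.
have ipos (u : T -> R) : measurable_fun setT u -> sqint mu u -> sqint mu u^\+.
  move=> mu_ ui; apply: (sqint_le (measurable_funrpos mu_) mu_ _ ui) => x.
  by rewrite /funrpos; case: (leP (u x) 0) => h; rewrite ?normr0.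
have ineg (u : T -> R) : measurable_fun setT u -> sqint mu u -> sqint mu u^\-.
  move=> mu_ ui; apply: (sqint_le (measurable_funrneg mu_) mu_ _ ui) => x.
  by rewrite /funrneg; case: (leP (- u x) 0) => h; rewrite ?normr0 ?normrN.
have mP (u : T -> R) (mu_ : measurable_fun setT u) :
    measurable_fun setT (EFin \o u^\+%R).
  by apply/measurable_EFinP; exact: measurable_funrpos.
have mN (u : T -> R) (mu_ : measurable_fun setT u) :
    measurable_fun setT (EFin \o u^\-%R).
  by apply/measurable_EFinP; exact: measurable_funrneg.
have P0 (u : T -> R) x : (0 <= (EFin \o u^\+%R) x)%E by rewrite lee_fin funrpos_ge0.
have N0 (u : T -> R) x : (0 <= (EFin \o u^\-%R) x)%E by rewrite lee_fin funrneg_ge0.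
have finP (u : T -> R) (mu_ : measurable_fun setT u) (ui : sqint mu u) :=
  kop_ae_fin (measurable_funrpos mu_) (funrpos_ge0 u) (ipos u mu_ ui).
have finN (u : T -> R) (mu_ : measurable_fun setT u) (ui : sqint mu u) :=
  kop_ae_fin (measurable_funrneg mu_) (funrneg_ge0 u) (ineg u mu_ ui).
have strong (u : T -> R) (mu_ : measurable_fun setT u) (ui : sqint mu u) :=
  weak_solution_strong mf fi mu_ ui (measurable_funrpos mu_) (measurable_funrneg mu_)
    (funrpos_ge0 u) (funrneg_ge0 u) (ipos u mu_ ui) (ineg u mu_ ui)
    (aeW mu (split_ u)).
pose w := u1 \- u2; have mw : measurable_fun setT w by exact: measurable_funB.
have iw : sqint mu w by exact: sqintB.
(* [subsolution_bound] wants [W] to be zero at every point off [S], whereas [u1] and [u2] vanish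
   there only almost everywhere; the indicator repairs this. *)
pose W x := (\1_S x : R) * `|w x|.
have W0 x : 0 <= W x by rewrite mulr_ge0.
have mW : measurable_fun setT W.
  apply: measurable_funM; first exact: measurable_indic.
  exact: measurableT_comp.
have mEW : measurable_fun setT (EFin \o W) by exact/measurable_EFinP.
have EW0 x : (0 <= (EFin \o W) x)%E by rewrite lee_fin.
have WS x : S x -> W x = `|w x| by move=> Sx; rewrite /W indicE mem_set// mul1r.
have W_off x : ~ S x -> W x = 0 by move=> Sx; rewrite /W indicE memNset// mul0r.
have iW : sqint mu W.
  apply: (sqint_le mW mw _ iw) => x.
  by rewrite /W normrM normr_id ler_piMl// indicE ger0_norm// lern1 leq_b1.
have wW : {ae mu, forall x, `|u1 x - u2 x| = W x}.
  apply: filterS2 z_u1 z_u2 => x z1 z2.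
  have [Sx|Sx] := pselect (S x); first by rewrite WS.
  by rewrite W_off// z1// z2// subrr normr0.
(* This is [K (v1 - v2) <= K W] with all negative parts moved across, so that [K] acts on
   nonnegative functions and no finiteness is involved yet. *)
have compare (v1 v2 : T -> R) : measurable_fun setT v1 -> measurable_fun setT v2 ->
    {ae mu, forall x, `|v1 x - v2 x| = W x} -> forall x,
    (K (EFin \o v1^\+%R) x + K (EFin \o v2^\-%R) x <=
     K (EFin \o v1^\-%R) x + K (EFin \o v2^\+%R) x + K (EFin \o W) x)%E.
  move=> m1' m2' vW x.
  have m12 := emeasurable_funD (mP _ m1') (mN _ m2').
  have m21 := emeasurable_funD (mN _ m1') (mP _ m2').
  have p21 y : (0 <= (EFin \o v1^\-%R) y + (EFin \o v2^\+%R) y)%E by rewrite adde_ge0.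
  rewrite -(kopD x (mP _ m1') (mN _ m2') (P0 v1) (N0 v2)).
  rewrite -(kopD x (mN _ m1') (mP _ m2') (N0 v1) (P0 v2)).
  rewrite -(kopD x m21 mEW p21 EW0).
  apply: le_kop_ae => //.
  - exact: emeasurable_funD.
  - by move=> y; rewrite adde_ge0.
  - by move=> y; rewrite !adde_ge0.
  apply: filterS vW => y vWy; rewrite -!EFinD lee_fin -vWy.
  have := ler_norm (v1 y - v2 y).
  by rewrite {1}(split_ v1) {1}(split_ v2); lra.
have wW' : {ae mu, forall x, `|u2 x - u1 x| = W x}.
  by apply: filterS wW => x; rewrite distrC.
(* Almost everywhere the four values of [K] on positive and negative parts are finite, so the strong
   equations can be subtracted; [compare] in both orders gives the two signs of the modulus. Where
   [K W x = +oo] nothing is to be shown. *)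
have sub : {ae mu, forall x, S x ->
    (a x * (EFin \o W) x <= cst 0%E x + K (EFin \o W) x)%E}.
  near=> x => Sx /=.
  have e1 : u1 x * ar x - (Kr u1^\+ x - Kr u1^\- x) = f x.
    by move: Sx; near: x; exact: strong weak1.
  have e2 : u2 x * ar x - (Kr u2^\+ x - Kr u2^\- x) = f x.
    by move: Sx; near: x; exact: strong weak2.
  have c12 := compare u1 u2 m_u1 m_u2 wW x.
  have c21 := compare u2 u1 m_u2 m_u1 wW' x.
  have k1 : K (EFin \o u1^\+%R) x \is a fin_num by near: x; exact: finP.
  have k2 : K (EFin \o u1^\-%R) x \is a fin_num by near: x; exact: finN.
  have k3 : K (EFin \o u2^\+%R) x \is a fin_num by near: x; exact: finP.
  have k4 : K (EFin \o u2^\-%R) x \is a fin_num by near: x; exact: finN.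
  rewrite -(fineK k1) -(fineK k2) -(fineK k3) -(fineK k4) in c12 c21.
  rewrite add0e WS//.
  move: c12 c21; have := kop_ge0 mu G0 EW0 x.
  case: (K (EFin \o W) x) => [s| |] // s0; last by move=> _ _; rewrite leey.
  rewrite -(fineK (a_fin x)) -!EFinD -EFinM !lee_fin /w /=.
  have ax0 : 0 <= ar x by rewrite fine_ge0.
  rewrite -[X in X * _]ger0_norm// -normrM ler_norml => c12 c21.
  by apply/andP; split; lra.
have W00 := subsolution_bound G0 mG mS M0 K20 row_le dissip
  (measurable_cst _ : measurable_fun setT (cst 0%E : T -> \bar R))
  (fun=> lexx _) mEW EW0 (fun x Sx => congr1 EFin (W_off x Sx)) iW sub.
have : (\int[mu]_x ((W x) ^+ 2)%:E <= 0)%E.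
  have : ((K2 * K2)%:E * \int[mu]_x ((W x) ^+ 2)%:E <= (K2 * K2)%:E * 0)%E.
    rewrite mule0; apply: le_trans W00 _.
    by rewrite (eq_integral (cst 0%E)) ?integral0// => x _; rewrite /= mul0e.
  by rewrite lee_pmul2l// lte_fin mulr_gt0.
move=> /(sqint_ae_eq0 mW) W0ae; apply: filterS2 wW W0ae => x wx Wx.
by apply/eqP; rewrite -subr_eq0 -normr_eq0 wx Wx.
Unshelve. all: by end_near.
Qed.
End weak_form.

(** * Euclidean space as an iterated product *)

(** The products of two increasing exhaustions by sets of finite measure exhaust the product. A
    bundled measure with the prescribed underlying function is what the recursion on the dimension
    consumes. *)
Lemma product_measure1_sigma_finite d1 d2 (T1 : measurableType d1)
    (T2 : measurableType d2) (R : realType)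
    (m1 : {sigma_finite_measure set T1 -> \bar R})
    (m2 : {sigma_finite_measure set T2 -> \bar R}) :
  exists m : {sigma_finite_measure set (T1 * T2)%type -> \bar R},
    (m : set (T1 * T2) -> \bar R) = (m1 \x m2)%E.
Proof.
have /sigma_finiteP[F [TF ndF Foo]] := sigma_finiteT m1.
have /sigma_finiteP[G [TG ndG Goo]] := sigma_finiteT m2.
have sf : sigma_finite setT (m1 \x m2)%E.
  exists (fun n => F n `*` G n).
    apply/esym/seteqP; split => // -[x y] _.
    have [n _ Fnx] : (\bigcup_n F n) x by rewrite -TF.
    have [k _ Gky] : (\bigcup_n G n) y by rewrite -TG.
    (* One index serves both coordinates because both exhaustions increase. *)
    exists (maxn n k) => //; split => /=.
    - by move: x Fnx; exact/subsetPset/ndF/leq_maxl.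
    - by move: y Gky; exact/subsetPset/ndG/leq_maxr.
  move=> k; have [? ?] := Foo k; have [? ?] := Goo k.
  split; first exact: measurableX.
  by rewrite product_measure1E// lte_mul_pinfty// ge0_fin_numE.
pose m : {sigma_finite_measure set (T1 * T2)%type -> \bar R} :=
  HB.pack (m1 \x m2)%E (Measure_isSigmaFinite.Build _ _ _ (m1 \x m2)%E sf).
by exists m.
Qed.

(** [lebRd] is defined by recursion as a bare set function, so its measure structure has to be
    rebuilt along the same recursion. *)
Lemma lebRd_sigma_finite (R : realType) (n : nat) :
  exists mu : {sigma_finite_measure set (Rd R n) -> \bar R},
    (mu : set (Rd R n) -> \bar R) = lebRd R n.
Proof.
elim: n => [|n [mu muE]]; first by exists (@lebesgue_measure R).
have [nu nuE] := product_measure1_sigma_finite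
  (@lebesgue_measure R : {sigma_finite_measure set (measurableTypeR R) -> \bar R}) mu.
by exists nu; rewrite /= -muE.
Qed.

Lemma measurable_cvec (R : realType) (n : nat) (i : 'I_n.+1) :
  measurable_fun setT (fun x : Rd R n => cvec x i 0).
Proof.
elim: n i => [|n IH] i.
  by rewrite (_ : (fun _ => _) = (fun x : Rd R 0 => x : R)) //; apply/funext => x; rewrite mxE.
have [j ->|j ->] := split_ordP (i : 'I_(1 + n.+1)).
- rewrite (_ : (fun _ => _) = (fun x : Rd R n.+1 => x.1 : R)).
    exact: measurable_fst.
  apply/funext => x; apply: etrans (@col_mxEu _ 1 n.+1 1 _ _ j 0) _.
  by rewrite mxE.
- rewrite (_ : (fun _ => _) = (fun x : Rd R n.+1 => cvec (x.2 : Rd R n) j 0)).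
    exact: (measurableT_comp (IH j) measurable_snd).
  by apply/funext => x; exact: (@col_mxEd _ 1 n.+1 1 _ _ j 0).
Qed.

(** Inverse of [cvec]. Continuity is argued on column vectors, while the coefficients are functions
    on [Rd R n]; this map transports them. *)
Fixpoint ofvec (R : realType) (n : nat) : 'cV[R]_n.+1 -> Rd R n :=
  match n return 'cV[R]_n.+1 -> Rd R n with
  | 0 => fun v => v 0 0
  | m.+1 => fun v => ((usubmx (v : 'cV_(1 + m.+1)) 0 0 : R), ofvec (dsubmx (v : 'cV_(1 + m.+1))))
  end.

Lemma cvecK (R : realType) (n : nat) : cancel (@cvec R n) (@ofvec R n).
Proof.
elim: n => [|n IH] x /=; first by rewrite mxE.
by case: x => a b /=; rewrite col_mxKu col_mxKd mxE IH.
Qed.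

Lemma ofvecK (R : realType) (n : nat) : cancel (@ofvec R n) (@cvec R n).
Proof.
elim: n => [|n IH] v /=.
  by apply/matrixP => i j; rewrite !mxE !ord1.
rewrite IH; apply: etrans (@vsubmxK _ 1 n.+1 1 v).
congr (@col_mx _ 1 n.+1 1 _ _).
by apply/matrixP => i j; rewrite !mxE !ord1.
Qed.

(** * Rational boxes and the Borel structure of the iterated product *)

Section rational_boxes.
Variables (R : realType) (n : nat).

(** Closed cubes with rational centre and half side [1 / (k + 1)], indexed by a countable type.
    Countability serves measurability of open sets, compactness serves the interaction domain. *)
Definition ratbox (b : {ffun 'I_n -> rat} * nat) : set 'cV[R]_n :=
  [set v | forall i, `|v i 0 - ratr (b.1 i)| <= b.2.+1%:R^-1].

Lemma open_ratbox (U : set 'cV[R]_n) (v : 'cV[R]_n) :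
  open U -> U v -> exists b, ratbox b v /\ ratbox b `<=` U.
Proof.
move=> oU Uv.
have /nbhs_ballP[e /= e0 eU] : nbhs v U by exact: open_nbhs_nbhs.
(* Both [v] and any other point of the box lie within [1 / (k + 1) < e / 2] of the centre in each
   coordinate, so they are less than [e] apart. *)
have e40 : 0 < e / 2 by rewrite divr_gt0.
have [k _ /(_ k (leqnn k)) /= ke] := near_infty_natSinv_lt (PosNum e40).
have k0 : 0 < k.+1%:R^-1 :> R by rewrite invr_gt0.
have /choice[q qP] (i : 'I_n) : exists q : rat, `|v i 0 - ratr q| <= k.+1%:R^-1.
  move: k0; set c := _^-1 => c0.
  have [|q] := @rat_in_itvoo R (v i 0 - c) (v i 0 + c); first lra.
  rewrite in_itv/= => /andP[h1 h2]; exists q; rewrite ler_norml.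
  by apply/andP; split; lra.
exists (finfun q, k); split => [i|w wq] /=; first by rewrite ffunE.
apply: eU; split => // i j; rewrite ord1 /ball/=.
have := wq i; have := qP i; rewrite /= ffunE !ler_norml ltr_norml.
move: ke; set c := _^-1 => ke /andP[h1 h2] /andP[h3 h4].
by apply/andP; split; lra.
Qed.

(** Products of segments are compact by [rV_compact], a fact about row vectors; the box is the image
    of such a product under the continuous transposition. *)
Lemma compact_ratbox b : compact (ratbox b).
Proof.
pose c : R := b.2.+1%:R^-1.
pose A (i : 'I_n) := [set` `[ratr (b.1 i) - c, ratr (b.1 i) + c]%R] : set R.
have cA : compact [set w : 'rV[R]_n | forall i, A i (w ord0 i)].
  by apply: rV_compact => i; exact: segment_compact.
have -> : ratbox b = [set w^T | w in [set w : 'rV[R]_n | forall i, A i (w ord0 i)]].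
  have bE v : ratbox b v <-> forall i, `|v i 0 - ratr (b.1 i)| <= c by [].
  move: c @A cA bE => c A _ bE.
  apply/seteqP; split => [v /bE vb|_ [w wA <-]] /=.
    exists v^T; last by rewrite trmxK.
    move=> i; rewrite mxE /A/= in_itv/=; have := vb i; rewrite ler_norml => /andP[h1 h2].
    by apply/andP; split; lra.
  apply/bE => i; rewrite mxE; have := wA i; rewrite /A/= in_itv/= ler_norml => /andP[h1 h2].
  by apply/andP; split; lra.
apply: continuous_compact cA; apply: continuous_subspaceT => w B [P wP PB].
exists (fun j i => P i j) => [j i|w' w'P]; first by have := wP i j; rewrite mxE.
by apply: PB => i j; rewrite mxE; exact: w'P.
Qed.

End rational_boxes.

Lemma measurable_bigcup_countType d (T : measurableType d) (I : countType)
    (P : set I) (F : I -> set T) :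
  (forall i, P i -> measurable (F i)) -> measurable (\bigcup_(i in P) F i).
Proof.
move=> mF; rewrite bigcup_mkcond; apply: countable_bigcupT_measurable.
  exact: countableP.
by move=> i; case: ifPn => // /set_mem; exact: mF.
Qed.

Lemma measurable_cvec_ratbox (R : realType) (n : nat) b :
  measurable (@cvec R n @^-1` ratbox b).
Proof.
rewrite (_ : _ @^-1` _ = \bigcap_(i in [set: 'I_n.+1])
    [set x : Rd R n | `|cvec x i 0 - ratr (b.1 i)| <= b.2.+1%:R^-1]); last first.
  by apply/seteqP; split => x xb i; [move=> _|]; exact: xb.
apply: fin_bigcap_measurable => // i _.
rewrite -[X in measurable X]setTI.
apply: (@measurable_fun_le _ _ _ setT (fun x : Rd R n => `|cvec x i 0 - ratr (b.1 i)|)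
  (cst (b.2.+1%:R^-1))) => //.
apply: measurableT_comp => //; apply: measurable_funB => //.
exact: measurable_cvec.
Qed.

(** An open set is the countable union of the rational boxes that it contains, and a box is cut out
    by finitely many measurable coordinates. *)
Lemma measurable_cvec_open (R : realType) (n : nat) (U : set 'cV[R]_n.+1) :
  open U -> measurable (@cvec R n @^-1` U).
Proof.
move=> oU.
rewrite (_ : _ @^-1` _ = \bigcup_(b in [set b | ratbox b `<=` U])
    (@cvec R n @^-1` ratbox b)).
  by apply: measurable_bigcup_countType => b _; exact: measurable_cvec_ratbox.
apply/seteqP; split => [x Ux|x [b bU xb]]; last exact: bU.
by have [b [xb bU]] := open_ratbox oU Ux; exists b.
Qed.

Lemma measurable_fun_cvec (R : realType) (n : nat) (h : 'cV[R]_n.+1 -> R) :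
  continuous h -> measurable_fun setT (h \o @cvec R n).
Proof.
move=> /continuousP ch; apply: (measurability _ (RGenOpens.measurableE R)).
move=> _ [_ [a [b ->] <-]]; rewrite setTI comp_preimage.
apply: measurable_cvec_open; apply: ch; exact: interval_open.
Qed.

(** * Measurability of the kernel and of the interaction domain *)

Section matrix_continuity.
Context (R : realType) (X : topologicalType).

Lemma continuous_mulr (f g : X -> R) : continuous f -> continuous g ->
  continuous (fun x => f x * g x).
Proof. by move=> cf cg x; apply: cvgM; [exact: cf|exact: cg]. Qed.

Lemma continuous_subr (f g : X -> R) : continuous f -> continuous g ->
  continuous (fun x => f x - g x).
Proof. by move=> cf cg x; apply: cvgB; [exact: cf|exact: cg]. Qed.

Lemma continuous_cstr (c : R) : continuous (fun _ : X => c).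
Proof. by move=> x; exact: cvg_cst. Qed.

Lemma continuous_sqrtr (f : X -> R) : continuous f ->
  continuous (fun x => Num.sqrt (f x)).
Proof.
by move=> cf x; apply: (@continuous_comp _ _ _ f Num.sqrt); [exact: cf|exact: sqrt_continuous].
Qed.

Lemma continuous_sumr (I : Type) (r : seq I) (F : I -> X -> R) :
  (forall i, continuous (F i)) -> continuous (fun x => \sum_(i <- r) F i x).
Proof.
by move=> cF x; apply: cvg_big => [|i _]; [exact: add_continuous|exact: cF].
Qed.

Lemma continuous_prodr (I : Type) (r : seq I) (F : I -> X -> R) :
  (forall i, continuous (F i)) -> continuous (fun x => \prod_(i <- r) F i x).
Proof.
by move=> cF x; apply: cvg_big => [|i _]; [exact: mul_continuous|exact: cF].
Qed.

Lemma continuous_det k (M : X -> 'M[R]_k) :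
  (forall i j, continuous (fun x => M x i j)) -> continuous (fun x => \det (M x)).
Proof.
move=> cM; apply: continuous_sumr => s x.
apply: cvgM; first exact: cvg_cst.
by apply: continuous_prodr => i; exact: cM.
Qed.

(** Cramer's rule: each entry is a cofactor divided by a determinant that does not vanish. *)
Lemma continuous_invmx k (M : X -> 'M[R]_k) (i j : 'I_k) :
  (forall i j, continuous (fun x => M x i j)) -> (forall x, M x \in unitmx) ->
  continuous (fun x => invmx (M x) i j).
Proof.
move=> cM uM.
rewrite (_ : (fun _ => _) = (fun x => (\det (M x))^-1 *
   ((-1) ^+ (j + i) * \det (row' j (col' i (M x)))))); last first.
  by apply/funext => x; rewrite /invmx uM !mxE.
move=> x; apply: cvgM.
  apply: (@cvgV _ _ _ _ (fun x => \det (M x))); last exact: continuous_det.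
  by have := uM x; rewrite unitmxE unitfE.
apply: cvgM; first exact: cvg_cst.
apply: continuous_det => i' j'.
by rewrite (_ : (fun _ => _) = (fun x => M x (lift j i') (lift i j'))) //;
  apply/funext => y; rewrite !mxE.
Qed.

End matrix_continuity.

Lemma quadE (R : realType) k (M : 'M[R]_k) (z : 'cV[R]_k) :
  quad M z = \sum_(j < k) (\sum_(i < k) z i 0 * M i j) * z j 0.
Proof.
rewrite /quad mxE; apply: eq_bigr => j _; rewrite mxE; congr (_ * _).
by apply: eq_bigr => i _; rewrite mxE.
Qed.

Lemma eucl2_eq0 (R : realType) k (z : 'cV[R]_k) : eucl2 z <= 0 -> z = 0.
Proof.
move=> z0; apply/matrixP => i j; rewrite ord1 mxE; apply/eqP; rewrite -sqrf_eq0.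
rewrite eq_le sqr_ge0 andbT; apply: le_trans z0; rewrite /eucl2 (bigD1 i)//= lerDl.
by apply: sumr_ge0 => *; exact: sqr_ge0.
Qed.

(** A vector [r] with [r M = 0] has zero quadratic form, so ellipticity forces [r = 0]. *)
Lemma elliptic_unitmx (R : realType) k (M : 'M[R]_k) (lam : R) : 0 < lam ->
  (forall xi, lam * eucl2 xi <= quad M xi) -> M \in unitmx.
Proof.
move=> lam0 ell; rewrite -row_free_unit -kermx_eq0; apply/eqP/row_matrixP => i.
set r := row i (kermx M).
have rM : r *m M = 0 by rewrite /r -row_mul mulmx_ker row0.
have : r^T = 0.
  apply: eucl2_eq0; have := ell r^T; rewrite /quad trmxK rM mul0mx mxE.
  by rewrite pmulr_rle0.
by move=> /(congr1 trmx); rewrite trmxK trmx0 row0.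
Qed.

Section domain.
Variables (R : realType) (n : nat) (A : Rd R n -> 'M[R]_n.+1).
Variables (lam L delta chi : R) (Omega_s : set 'cV[R]_n.+1).
Hypotheses (lam0 : 0 < lam) (oO : open Omega_s).
Hypothesis lipA : forall x y (i j : 'I_n.+1),
  `|A x i j - A y i j| <= L * Num.sqrt (eucl2 (cvec x - cvec y)).
Hypothesis ellA : forall x (xi : 'cV[R]_n.+1), lam * eucl2 xi <= quad (A x) xi.

(** The Lipschitz bound is in the Euclidean norm and the topology of column vectors in the sup norm.
    The gap is bridged by continuity of [w |-> L * Num.sqrt (eucl2 (v - w))], whose value at [v] is
    zero. *)
Lemma continuous_coef i j : continuous (fun v => A (ofvec v) i j).
Proof.
move=> v; apply/(@cvgrPdist_lt _ _ _ (nbhs v)) => e e0.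
have ch : continuous (fun w : 'cV[R]_n.+1 => L * Num.sqrt (eucl2 (v - w))).
  apply: continuous_mulr; first exact: continuous_cstr.
  apply: continuous_sqrtr; apply: continuous_sumr => k.
  have cc : continuous (fun w : 'cV[R]_n.+1 => (v - w) k 0).
    rewrite (_ : (fun _ => _) = (fun w : 'cV[R]_n.+1 => v k 0 - w k 0)); last first.
      by apply/funext => w'; rewrite !mxE.
    by apply: continuous_subr; [exact: continuous_cstr|exact: coord_continuous].
  exact: (continuous_mulr cc cc).
have h0 : L * Num.sqrt (eucl2 (v - v)) = 0.
  rewrite subrr /eucl2 big1 ?sqrtr0 ?mulr0// => k _.
  by rewrite mxE expr0n.
have near_v := @cvgr_dist_lt _ _ _ (nbhs v) _ _ _ (ch v) _ e0.
rewrite h0 in near_v; near=> w.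
have : `|0 - L * Num.sqrt (eucl2 (v - w))| < e by near: w; exact: near_v.
rewrite sub0r normrN; apply: le_lt_trans; apply: le_trans (ler_norm _).
by have := lipA (ofvec v) (ofvec w) i j; rewrite !ofvecK.
Unshelve. all: by end_near.
Qed.

Let unitA x : A x \in unitmx.
Proof. exact: elliptic_unitmx lam0 (ellA x). Qed.

Lemma continuous_inv_coef i j : continuous (fun v => invmx (A (ofvec v)) i j).
Proof. by apply: continuous_invmx; [exact: continuous_coef|]. Qed.

Lemma continuous_metric : continuous (fun z : 'cV[R]_n.+1 * 'cV[R]_n.+1 =>
  quad (invmx (A (ofvec z.1))) (z.2 - z.1)).
Proof.
have cz i : continuous (fun z : 'cV[R]_n.+1 * 'cV[R]_n.+1 => (z.2 - z.1) i 0).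
  rewrite (_ : (fun _ => _) = (fun z : 'cV[R]_n.+1 * 'cV[R]_n.+1 => z.2 i 0 - z.1 i 0)); last first.
    by apply/funext => z; rewrite !mxE.
  apply: continuous_subr => z.
  - apply: (@continuous_comp _ _ _ snd (fun w : 'cV[R]_n.+1 => w i 0)).
      exact: cvg_snd.
    exact: coord_continuous.
  - apply: (@continuous_comp _ _ _ fst (fun w : 'cV[R]_n.+1 => w i 0)).
      exact: cvg_fst.
    exact: coord_continuous.
rewrite (_ : (fun _ => _) = (fun z : 'cV[R]_n.+1 * 'cV[R]_n.+1 => \sum_(j < n.+1)
   (\sum_(i < n.+1) (z.2 - z.1) i 0 * invmx (A (ofvec z.1)) i j) * (z.2 - z.1) j 0)).
  apply: continuous_sumr => j; apply: continuous_mulr; last exact: cz.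
  apply: continuous_sumr => i; apply: continuous_mulr; first exact: cz.
  move=> z; apply: (@continuous_comp _ _ _ fst (fun v => invmx (A (ofvec v)) i j)).
    exact: cvg_fst.
  exact: continuous_inv_coef.
by apply/funext => z; exact: quadE.
Qed.

Lemma measurable_metric : measurable_fun setT (fun z : Rd R n * Rd R n =>
  quad (invmx (A z.1)) (cvec z.2 - cvec z.1)).
Proof.
have mz i : measurable_fun setT (fun z : Rd R n * Rd R n => (cvec z.2 - cvec z.1) i 0).
  rewrite (_ : (fun _ => _) = (fun z : Rd R n * Rd R n => cvec z.2 i 0 - cvec z.1 i 0)); last first.
    by apply/funext => z; rewrite !mxE.
  apply: measurable_funB.
  - exact: (measurableT_comp (measurable_cvec i) measurable_snd).
  - exact: (measurableT_comp (measurable_cvec i) measurable_fst).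
have mA i j : measurable_fun setT (fun x => invmx (A x) i j).
  rewrite (_ : (fun _ => _) = (fun v => invmx (A (ofvec v)) i j) \o @cvec R n).
    apply: measurable_fun_cvec; exact: continuous_inv_coef.
  by apply/funext => x; rewrite /= cvecK.
rewrite (_ : (fun _ => _) = (fun z : Rd R n * Rd R n => \sum_(j < n.+1)
   (\sum_(i < n.+1) (cvec z.2 - cvec z.1) i 0 * invmx (A z.1) i j) * (cvec z.2 - cvec z.1) j 0)).
  apply: measurable_sum => j; apply: measurable_funM => //.
  apply: measurable_sum => i; apply: measurable_funM => //.
  exact: (measurableT_comp (mA i j) measurable_fst).
by apply/funext => z; exact: quadE.
Qed.

Lemma measurable_gamma_trunc : measurable_fun setT (fun z : Rd R n * Rd R n =>
  gamma_trunc A delta chi z.1 z.2).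
Proof.
pose q (z : Rd R n * Rd R n) := quad (invmx (A z.1)) (cvec z.2 - cvec z.1).
have mD : measurable [set z | q z <= delta ^+ 2 * chi].
  rewrite -[X in measurable X]setTI.
  by apply: (@measurable_fun_le _ _ _ setT q (cst (delta ^+ 2 * chi))) => //; exact: measurable_metric.
rewrite (_ : (fun _ => _) = (fun z => gamma_ker A delta z.1 z.2 *
    \1_[set z | q z <= delta ^+ 2 * chi] z)); last first.
  apply/funext => z; rewrite /gamma_trunc indicE -/(q z).
  have [qz|qz] := boolP (q z <= delta ^+ 2 * chi); first by rewrite mem_set// mulr1.
  by rewrite memNset ?mulr0// => /=; apply/negP.
apply: measurable_funM; last exact: measurable_indic.
apply: measurable_funM.
  apply: measurable_funM => //; apply: measurable_funV.
  apply: (measurableT_comp (continuous_measurable_fun (@sqrt_continuous R))).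
  apply: measurable_funM => //.
  have mdet : measurable_fun setT (fun x => \det (delta ^+ 2 *: A x)).
    rewrite (_ : (fun _ => _) = (fun v => \det (delta ^+ 2 *: A (ofvec v))) \o @cvec R n).
      apply: measurable_fun_cvec; apply: continuous_det => i j.
      rewrite (_ : (fun _ => _) = (fun v => delta ^+ 2 * A (ofvec v) i j)); last first.
        by apply/funext => w; rewrite mxE.
      by apply: continuous_mulr; [exact: continuous_cstr|exact: continuous_coef].
    by apply/funext => x; rewrite /= cvecK.
  exact: (measurableT_comp mdet measurable_fst).
apply: (measurableT_comp (continuous_measurable_fun (@continuous_expR R))).
apply: measurable_funM => //; apply: measurableT_comp => //; exact: measurable_metric.
Qed.

Lemma measurable_Os : measurable (Os Omega_s).
Proof. exact: measurable_cvec_open. Qed.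

(* The union of the influence regions is F_sigma: it is a countable union of
   projections of compact sets. *)
Lemma measurable_Oc : measurable (Oc A delta chi Omega_s).
Proof.
pose D (b b' : {ffun 'I_n.+1 -> rat} * nat) := ratbox b `*` ratbox b' `&`
  [set z | quad (invmx (A (ofvec z.1))) (z.2 - z.1) <= delta ^+ 2 * chi].
(* A projection of a closed set need not be closed; restricting to a product of two boxes makes the
   set compact, and so is its image. *)
have cD b b' : closed [set z.2 | z in D b b'].
  apply: compact_closed; first exact: norm_hausdorff.
  apply: continuous_compact.
    by apply: continuous_subspaceT => z; exact: cvg_snd.
  apply: compact_closedI.
    by apply: compact_setX; exact: compact_ratbox.
  apply: (preimage_closed (f := fun z : 'cV[R]_n.+1 * 'cV[R]_n.+1 =>
    quad (invmx (A (ofvec z.1))) (z.2 - z.1))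
    (D := [set t | t <= delta ^+ 2 * chi])).
    by move=> z _; exact: continuous_metric.
  exact: closed_le.
pose U : set (Rd R n) :=
  [set y | exists x, Os Omega_s x /\ infl_region A delta chi x y].
have -> : Oc A delta chi Omega_s = ~` Os Omega_s `&` U by [].
apply: measurableI; first by apply: measurableC; exact: measurable_Os.
(* Boxes [b] inside Omega_s locate the source point [x], openness guaranteeing that they cover; the
   boxes [b'] for the target range over the whole space. *)
rewrite (_ : U = \bigcup_(b in [set b | ratbox b `<=` Omega_s])
   \bigcup_(b' in setT) (@cvec R n @^-1` [set z.2 | z in D b b'])); last first.
  apply/seteqP; split => [y [x [Ox xy]]|y [b bO [b' _ [[v w]]]]] /=.
    have [b [xb bO]] := open_ratbox oO Ox.
    have [b' [yb' _]] := open_ratbox (@openT _) (I : setT (cvec y)).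
    exists b => //; exists b' => //; exists (cvec x, cvec y) => //.
    by split => //=; rewrite cvecK.
  move=> [[vb wb'] /= vw] wy; exists (ofvec v); split.
    by rewrite /Os /= ofvecK; exact: bO.
  by rewrite /infl_region /= ofvecK -wy.
apply: measurable_bigcup_countType => b _.
apply: measurable_bigcup_countType => b' _.
rewrite -[X in measurable X]setCK; apply: measurableC.
rewrite preimage_setC; apply: measurable_cvec_open.
exact: closed_openC.
Qed.

Lemma gamma_trunc_ge0 x y : 0 <= gamma_trunc A delta chi x y.
Proof.
rewrite /gamma_trunc; case: ifP => // _.
rewrite /gamma_ker !mulr_ge0 ?invr_ge0 ?sqrtr_ge0 ?expR_ge0 ?sqr_ge0//.
Qed.

End domain.

(** * Restriction to the domain *)

Section extension.
Context d (T : measurableType d) (R : realType).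
Variable mu : {sigma_finite_measure set T -> \bar R}.
Variables (g : T -> T -> R) (S C : set T) (M K1 K2 : R).
Hypothesis g0 : forall x y, 0 <= g x y.
Hypothesis mg : measurable_fun setT (fun z : T * T => g z.1 z.2).
Hypotheses (mS : measurable S) (mC : measurable C) (SC : S `&` C = set0).
Let Om := S `|` C.

Let mOm : measurable Om.
Proof. exact: measurableU. Qed.

(** Cutting off in both variables turns integrals over [Om] into integrals over the whole space, and
    the kernel bounds, assumed only for [x] in [Om], become valid everywhere. *)
Definition extended_kernel x y : R := g x y * \1_Om x * \1_Om y.
Local Notation G := extended_kernel.

Lemma extended_kernel_ge0 x y : 0 <= G x y.
Proof. by rewrite /G !mulr_ge0 ?g0. Qed.

Lemma measurable_extended_kernel : measurable_fun setT (fun z : T * T => G z.1 z.2).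
Proof.
apply: measurable_funM; first apply: measurable_funM => //.
- exact: (measurableT_comp (measurable_indic mOm) measurable_fst).
- exact: (measurableT_comp (measurable_indic mOm) measurable_snd).
Qed.

Lemma restrictE (u : T -> R) x : Om x -> (u \_ Om) x = u x.
Proof. by move=> Ox; rewrite patchE mem_set. Qed.

Lemma restrictN (u : T -> R) x : ~ Om x -> (u \_ Om) x = 0.
Proof. by move=> Ox; rewrite patchE memNset. Qed.

Lemma integral_restrict (D : set T) (h k : T -> R) :
  (forall x, D x -> h x = k x) -> (forall x, ~ D x -> k x = 0) ->
  (\int[mu]_(x in D) (h x)%:E = \int[mu]_x (k x)%:E)%E.
Proof.
move=> hk k0; rewrite integral_mkcond; apply: eq_integral => x _.
rewrite patchE; case: ifPn => [/set_mem Dx|/negP Dx]; first by rewrite hk.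
by rewrite k0// => Dx'; apply: Dx; rewrite mem_set.
Qed.

Lemma weak_form_extension (u v : T -> R) :
  (\int[mu]_(x in Om) \int[mu]_(y in Om) (((u x - u y) * v x * g x y)%R)%:E =
   weak_form mu G (u \_ Om) (v \_ Om))%E.
Proof.
rewrite integral_mkcond; apply: eq_integral => x _.
rewrite patchE; case: ifPn => [/set_mem Ox|/negP Ox].
  apply: integral_restrict => y Oy.
    by rewrite /G !restrictE// !indicE !mem_set// !mulr1.
  by rewrite /G (indicE R Om y) memNset// !mulr0.
have {}Ox : ~ Om x by move=> Ox'; apply: Ox; rewrite mem_set.
rewrite (eq_integral (cst 0%E)) ?integral0// => y _.
by rewrite (restrictN v)//= mulr0 mul0r.
Qed.

Lemma weak_form_restrictr (u v : T -> R) :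
  weak_form mu G u (v \_ Om) = weak_form mu G u v.
Proof.
apply: eq_integral => x _; apply: eq_integral => y _; congr (_%:E).
have [Ox|Ox] := pselect (Om x); first by rewrite restrictE.
by rewrite /G (indicE R Om x) memNset// mulr0 mul0r !mulr0.
Qed.

Hypotheses (M0 : 0 < M) (K10 : 0 < K1) (K20 : 0 < K2).
Hypothesis row_le : forall x, Om x -> (\int[mu]_(y in Om) (g x y)%:E <= M%:E)%E.
Hypothesis col_le : forall x, Om x -> (\int[mu]_(y in Om) (g y x)%:E <= K1%:E)%E.
Hypothesis boundary_ge : forall x, Om x ->
  (K2%:E <= \int[mu]_(y in C) ((g x y + g y x) / 2)%:E)%E.
Hypothesis asym_ge0 : forall x, Om x ->
  (0 <= \int[mu]_(y in Om) ((g x y - g y x) / 2)%:E)%E.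

Let kopE (w : T -> R) x : Om x ->
  (kop mu G (EFin \o w) x = \int[mu]_(y in Om) (g x y * w y)%:E)%E.
Proof.
move=> Ox; rewrite (@integral_restrict Om _ (fun y => G x y * w y)) => [|y Oy|y Oy].
- by apply: eq_integral => y _; rewrite EFinM.
- by rewrite /G !indicE !mem_set// !mulr1.
- by rewrite /G (indicE R Om y) memNset// mulr0 mul0r.
Qed.

Let kop_trE (w : T -> R) x : Om x ->
  (kop_tr mu G (EFin \o w) x = \int[mu]_(y in Om) (g y x * w y)%:E)%E.
Proof.
move=> Ox; rewrite (@integral_restrict Om _ (fun y => G y x * w y)) => [|y Oy|y Oy].
- by apply: eq_integral => y _; rewrite EFinM.
- by rewrite /G !indicE !mem_set// !mulr1.
- by rewrite /G (indicE R Om y) memNset// mulr0 !mul0r.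
Qed.

Let aE x : Om x -> (kop mu G (cst 1%E) x = \int[mu]_(y in Om) (g x y)%:E)%E.
Proof.
by move=> Ox; rewrite (kopE (cst 1) Ox); apply: eq_integral => y _; rewrite mulr1.
Qed.

Let atE x : Om x -> (kop_tr mu G (cst 1%E) x = \int[mu]_(y in Om) (g y x)%:E)%E.
Proof.
by move=> Ox; rewrite (kop_trE (cst 1) Ox); apply: eq_integral => y _; rewrite mulr1.
Qed.

Lemma extended_row_le x : (kop mu G (cst 1%E) x <= M%:E)%E.
Proof.
have [Ox|Ox] := pselect (Om x); first by rewrite aE// row_le.
rewrite /kop (eq_integral (cst 0%E)) ?integral0 ?lee_fin ?ltW// => y _.
by rewrite /G (indicE R Om x) memNset// mulr0 mul0r mul0e.
Qed.

Lemma extended_col_le x : (kop_tr mu G (cst 1%E) x <= K1%:E)%E.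
Proof.
have [Ox|Ox] := pselect (Om x); first by rewrite atE// col_le.
rewrite /kop_tr (eq_integral (cst 0%E)) ?integral0 ?lee_fin ?ltW// => y _.
by rewrite /G (indicE R Om x) memNset// mulr0 mul0e.
Qed.

(** Let [s1], [c1] be the masses of [g x] over [S] and [C], and [s2], [c2] those of the transposed
    kernel. The boundary hypothesis is [2 K2 <= c1 + c2], the asymmetry hypothesis is
    [s2 + c2 <= s1 + c1]; adding them gives [s1 + s2 + 2 K2 <= 2 (s1 + c1)]. The row and column
    bounds make all four masses finite. *)
Lemma extended_dissip x : S x ->
  (kop mu G (fun y => (\1_S y : R)%:E) x + kop_tr mu G (fun y => (\1_S y : R)%:E) x
     + (2 * K2)%:E <= 2%:E * kop mu G (cst 1%E) x)%E.
Proof.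
move=> Sx; have Ox : Om x by left.
have mgx : measurable_fun setT (fun y => (g x y)%:E).
  by apply/measurable_EFinP; exact: (measurableT_comp mg (measurable_pair1 x)).
have mgtx : measurable_fun setT (fun y => (g y x)%:E).
  by apply/measurable_EFinP; exact: (measurableT_comp mg (measurable_pair2 x)).
have dSC : [disjoint S & C] by apply/disj_setPS; rewrite SC.
have sE : (kop mu G (fun y => (\1_S y : R)%:E) x = \int[mu]_(y in S) (g x y)%:E)%E.
  rewrite (@integral_restrict S _ (fun y => G x y * \1_S y)) => [|y Sy|y Sy].
  - by apply: eq_integral => y _; rewrite EFinM.
  - by rewrite /G !indicE !mem_set ?mulr1//; left.
  - by rewrite (indicE R S y) memNset// mulr0.
have stE : (kop_tr mu G (fun y => (\1_S y : R)%:E) x = \int[mu]_(y in S) (g y x)%:E)%E.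
  rewrite (@integral_restrict S _ (fun y => G y x * \1_S y)) => [|y Sy|y Sy].
  - by apply: eq_integral => y _; rewrite EFinM.
  - by rewrite /G !indicE !mem_set ?mulr1//; left.
  - by rewrite (indicE R S y) memNset// mulr0.
have splitU (h : T -> \bar R) : measurable_fun setT h -> (forall y, 0 <= h y)%E ->
    (\int[mu]_(y in Om) h y = \int[mu]_(y in S) h y + \int[mu]_(y in C) h y)%E.
  by move=> mh h0; rewrite ge0_integral_setU//; exact: measurable_funTS.
have g0E y : (0 <= (g x y)%:E)%E by rewrite lee_fin.
have gt0E y : (0 <= (g y x)%:E)%E by rewrite lee_fin.
have hM := row_le Ox; have hK := col_le Ox.
have hb : ((2 * K2)%:E <= \int[mu]_(y in C) (g x y)%:E + \int[mu]_(y in C) (g y x)%:E)%E.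
  have := boundary_ge Ox.
  have -> : (\int[mu]_(y in C) ((g x y + g y x) / 2)%:E =
     (2^-1)%:E * (\int[mu]_(y in C) (g x y)%:E + \int[mu]_(y in C) (g y x)%:E))%E.
    rewrite -ge0_integralD//; [|exact: measurable_funTS..].
    rewrite -ge0_integralZl ?lee_fin//; last 2 first.
    - by apply: emeasurable_funD; exact: measurable_funTS.
    - by move=> y _; rewrite adde_ge0.
    by apply: eq_integral => y _; rewrite -EFinD -EFinM mulrC.
  have two0 : (0 <= 2%:E :> \bar R)%E by rewrite lee_fin.
  move=> /(lee_wpmul2l two0); rewrite -EFinM => /le_trans; apply.
  by rewrite muleA -EFinM divff// mul1e.
have igx : mu.-integrable Om (fun y => (g x y)%:E).
  apply/integrableP; split; first exact: measurable_funTS.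
  under eq_integral => y _ do rewrite gee0_abs//.
  by apply: le_lt_trans hM _; rewrite ltry.
have igtx : mu.-integrable Om (fun y => (g y x)%:E).
  apply/integrableP; split; first exact: measurable_funTS.
  under eq_integral => y _ do rewrite gee0_abs//.
  by apply: le_lt_trans hK _; rewrite ltry.
have ha : (\int[mu]_(y in Om) (g y x)%:E <= \int[mu]_(y in Om) (g x y)%:E)%E.
  have := asym_ge0 Ox.
  have -> : (\int[mu]_(y in Om) ((g x y - g y x) / 2)%:E =
     (2^-1)%:E * (\int[mu]_(y in Om) (g x y)%:E - \int[mu]_(y in Om) (g y x)%:E))%E.
    rewrite -integralB// -integralZl//; last exact: integrableB.
    by apply: eq_integral => y _; rewrite -EFinB -EFinM mulrC.
  rewrite pmule_rge0 ?lte_fin// sube_ge0//.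
  by rewrite (integrable_fin_num mOm igtx).
rewrite sE stE aE//.
move: hM hK hb ha; rewrite !splitU//.
have i0 (D : set T) (h : T -> \bar R) : (forall y, 0 <= h y)%E -> (0 <= \int[mu]_(y in D) h y)%E.
  by move=> h0; exact: integral_ge0.
move: (i0 S _ g0E) (i0 C _ g0E) (i0 S _ gt0E) (i0 C _ gt0E).
case: (\int[mu]_(y in S) (g x y)%:E)%E => [s1| |] //;
case: (\int[mu]_(y in C) (g x y)%:E)%E => [c1| |] //;
case: (\int[mu]_(y in S) (g y x)%:E)%E => [s2| |] //;
case: (\int[mu]_(y in C) (g y x)%:E)%E => [c2| |] //.
rewrite -!EFinD -!EFinM !lee_fin => _ _ _ _ _ _; lra.
Qed.

(** This and the next two definitions mirror the notions of the statement for an abstract measure,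
    so that the final instantiation holds by conversion. *)
Definition L2_on (u : T -> R) : Prop :=
  measurable_fun Om u /\ (\int[mu]_(x in Om) ((u x ^+ 2)%R)%:E < +oo)%E.

Definition L2_vanishing (u : T -> R) : Prop :=
  L2_on u /\ mu.-negligible [set x | C x /\ u x <> 0].

Definition bilinear (u v : T -> R) : \bar R :=
  (\int[mu]_(x in Om) \int[mu]_(y in Om) (((u x - u y) * v x * g x y)%R)%:E)%E.

Let sqr_restrict (u : T -> R) :
  (\int[mu]_(x in Om) ((u x ^+ 2)%R)%:E = \int[mu]_x (((u \_ Om) x ^+ 2)%R)%:E)%E.
Proof.
apply: integral_restrict => x Ox; first by rewrite restrictE.
by rewrite restrictN// expr0n.
Qed.

Let L2_on_restrict u : L2_on u ->
  measurable_fun setT (u \_ Om) /\ sqint mu (u \_ Om).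
Proof.
move=> [mu_ ui]; split; first exact/(measurable_restrictT _ mOm).
by move: ui; rewrite sqr_restrict.
Qed.

Let vanishing_restrict u : L2_vanishing u ->
  {ae mu, forall x, ~ S x -> (u \_ Om) x = 0}.
Proof.
move=> [_]; apply: negligibleS => x /= h.
have [Ox|Ox] := pselect (Om x); last by exfalso; apply: h; rewrite restrictN.
move: h; rewrite restrictE// => /not_implyP[Sx ux].
by split => //; case: Ox.
Qed.

Let restrict_le (u : T -> R) : measurable_fun setT u ->
  (\int[mu]_(x in Om) ((u x ^+ 2)%R)%:E <= \int[mu]_x ((u x ^+ 2)%R)%:E)%E.
Proof.
move=> mu_; apply: ge0_subset_integral => //; first exact: measurable_sqr.
by move=> x _; rewrite lee_fin sqr_ge0.
Qed.

Let L2_vanishing_of v : measurable_fun setT v -> sqint mu v ->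
  {ae mu, forall x, ~ S x -> v x = 0} -> L2_vanishing v.
Proof.
move=> mv vi vS; split; first split.
- exact: measurable_funTS.
- exact: le_lt_trans (restrict_le mv) vi.
- apply: negligibleS vS => x [Cx vx] /= h; apply: vx; apply: h => Sx.
  by have : (S `&` C) x by []; rewrite SC.
Qed.

Let integralM_restrict (f v : T -> R) :
  (\int[mu]_(x in Om) ((f x * v x)%R)%:E =
   \int[mu]_x (((f \_ Om) x * (v \_ Om) x)%R)%:E)%E.
Proof.
apply: integral_restrict => x Ox; first by rewrite !restrictE.
by rewrite restrictN// mul0r.
Qed.

Theorem nonlocal_well_posed (f : T -> R) : L2_on f ->
  (exists u : T -> R,
     [/\ L2_vanishing u,
         (forall v, L2_vanishing v ->
            bilinear u v = (\int[mu]_(x in Om) ((f x * v x)%R)%:E)%E) &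
         Num.sqrt (fine (\int[mu]_(x in Om) ((u x ^+ 2)%R)%:E)) <=
           2 / K2 * Num.sqrt (fine (\int[mu]_(x in Om) ((f x ^+ 2)%R)%:E))]) /\
  (forall u1 u2 : T -> R, L2_vanishing u1 -> L2_vanishing u2 ->
     (forall v, L2_vanishing v ->
        bilinear u1 v = (\int[mu]_(x in Om) ((f x * v x)%R)%:E)%E) ->
     (forall v, L2_vanishing v ->
        bilinear u2 v = (\int[mu]_(x in Om) ((f x * v x)%R)%:E)%E) ->
     mu.-negligible [set x | Om x /\ u1 x <> u2 x]).
Proof.
move=> L2f; have [mf fi] := L2_on_restrict L2f; split.
  have [u [mu_ uS ub uweak]] := weak_solution_exists extended_kernel_ge0
    measurable_extended_kernel mS M0 K10 K20 extended_row_le extended_col_le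
    extended_dissip mf fi.
  have K220 : 0 < K2 * K2 by rewrite mulr_gt0.
  have I0 (w : T -> R) (D : set T) : (0 <= \int[mu]_(x in D) ((w x ^+ 2)%R)%:E)%E.
    by apply: integral_ge0 => x _; rewrite lee_fin sqr_ge0.
  have ui : sqint mu u.
    move: (I0 u setT) (le_lt_trans ub fi); rewrite /sqint.
    case: (\int[mu]_x ((u x ^+ 2)%R)%:E)%E => [r| |] // _; first by move=> _; rewrite ltry.
    by rewrite gt0_muley ?lte_fin.
  have Vu := L2_vanishing_of mu_ ui (aeW mu uS).
  have uE : u \_ Om = u.
    apply/funext => x; have [Ox|Ox] := pselect (Om x); first by rewrite restrictE.
    by rewrite restrictN// uS// => Sx; apply: Ox; left.
  exists u; split => //.
    move=> v Vv; have [mv vi] := L2_on_restrict Vv.1.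
    rewrite /bilinear weak_form_extension uE integralM_restrict.
    exact/uweak/vanishing_restrict.
  rewrite !sqr_restrict uE.
  move: ub (I0 u setT) (I0 (f \_ Om) setT) fi; rewrite /sqint.
  case: (\int[mu]_x (((f \_ Om) x ^+ 2)%R)%:E)%E => [b| |] //.
  case: (\int[mu]_x ((u x ^+ 2)%R)%:E)%E => [c| |] //; last first.
    by rewrite gt0_muley ?lte_fin.
  rewrite -EFinM !lee_fin /= => cb c0 b0 _.
  apply: (@le_trans _ _ (K2^-1 * Num.sqrt b)).
    rewrite ler_pdivlMl// -[X in X * _](@ger0_norm _ K2) ?(ltW K20)// -sqrtr_sqr.
    by rewrite -sqrtrM ?sqr_ge0// ler_sqrt.
  (* The estimate obtained has constant [1 / K2], which is at most [2 / K2]. *)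
  by rewrite ler_wpM2r ?sqrtr_ge0// ler_pMl ?invr_gt0// ler1n.
move=> u1 u2 V1 V2 weak1 weak2.
have [m1 i1] := L2_on_restrict V1.1; have [m2 i2] := L2_on_restrict V2.1.
(* Test functions on the whole space may be cut off to [Om]: the extended kernel on one side and the
   restricted [f] on the other ignore their values outside. *)
have weak (u : T -> R) : (forall v, L2_vanishing v ->
    bilinear u v = (\int[mu]_(x in Om) ((f x * v x)%R)%:E)%E) ->
    forall v, measurable_fun setT v -> sqint mu v -> {ae mu, forall x, ~ S x -> v x = 0} ->
    weak_form mu G (u \_ Om) v = (\int[mu]_x ((f \_ Om) x * v x)%:E)%E.
  move=> uweak v mv vi vS; rewrite -weak_form_restrictr -weak_form_extension.
  have := uweak v (L2_vanishing_of mv vi vS); rewrite /bilinear => ->.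
  rewrite integralM_restrict; apply: eq_integral => x _; congr (_%:E).
  have [Ox|Ox] := pselect (Om x); first by rewrite !restrictE.
  by rewrite !restrictN// !mul0r.
have := weak_solution_unique extended_kernel_ge0
    measurable_extended_kernel mS M0 K10 K20 extended_row_le extended_col_le
    extended_dissip mf fi m1 i1 (vanishing_restrict V1) m2 i2 (vanishing_restrict V2)
    (weak _ weak1) (weak _ weak2).
apply: negligibleS => x [Ox u12] /= h; apply: u12.
by move: h; rewrite !restrictE.
Qed.

End extension.

(* d = n.+1 >= 1; points of R^d are elements of Rd R n, with coordinates cvec x. *)
Theorem mainTheorem1 (R : realType) (n : nat)
    (Omega_s : set 'cV[R]_n.+1) (A : Rd R n -> 'M[R]_n.+1)
    (lam Lam delta alpha chi K1 K2 : R) (f : Rd R n -> R) :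
  bounded_lipschitz_domain Omega_s ->
  (forall x, (A x)^T = A x) ->
  (exists L : R, forall x y (i j : 'I_n.+1),
      `|A x i j - A y i j| <= L * Num.sqrt (eucl2 (cvec x - cvec y))) ->
  0 < lam -> lam <= Lam ->
  (forall x (xi : 'cV[R]_n.+1),
      lam * eucl2 xi <= quad (A x) xi /\ quad (A x) xi <= Lam * eucl2 xi) ->
  0 < delta -> 0 < alpha -> alpha < 1 ->
  is_chi2_quantile n alpha chi ->
  0 < K1 -> 0 < K2 ->
  (forall x, Om A delta chi Omega_s x ->
     [/\ (\int[lebRd R n]_(y in Om A delta chi Omega_s)
            (gamma_trunc A delta chi x y)%:E <= (2 / delta ^+ 2)%:E)%E,
         (\int[lebRd R n]_(y in Om A delta chi Omega_s)
            (gamma_trunc A delta chi y x)%:E <= K1%:E)%E,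
         (K2%:E <= \int[lebRd R n]_(y in Oc A delta chi Omega_s)
            ((gamma_trunc A delta chi x y + gamma_trunc A delta chi y x) / 2)%:E)%E &
         (0 <= \int[lebRd R n]_(y in Om A delta chi Omega_s)
            ((gamma_trunc A delta chi x y - gamma_trunc A delta chi y x) / 2)%:E)%E]) ->
  L2 A delta chi Omega_s f ->
  (exists u : Rd R n -> R,
     [/\ L2n0 A delta chi Omega_s u,
         (forall v, L2n0 A delta chi Omega_s v ->
            Bform A delta chi Omega_s u v = Fform A delta chi Omega_s f v) &
         L2norm A delta chi Omega_s u <= 2 / K2 * L2norm A delta chi Omega_s f])
  /\
  (forall u1 u2 : Rd R n -> R,
     L2n0 A delta chi Omega_s u1 -> L2n0 A delta chi Omega_s u2 ->
     (forall v, L2n0 A delta chi Omega_s v ->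
        Bform A delta chi Omega_s u1 v = Fform A delta chi Omega_s f v) ->
     (forall v, L2n0 A delta chi Omega_s v ->
        Bform A delta chi Omega_s u2 v = Fform A delta chi Omega_s f v) ->
     (lebRd R n).-negligible
       [set x | Om A delta chi Omega_s x /\ u1 x <> u2 x]).
Proof.
move=> [oO _ _ _] _ [L lipA] lam0 _ ell delta0 _ _ _ K10 K20.
have [mu muE] := lebRd_sigma_finite R n.
have ellA x xi : lam * eucl2 xi <= quad (A x) xi := (ell x xi).1.
(* Replaces the bare set function by the bundled measure [mu], to which the abstract theorem
   applies. *)
rewrite /L2n0 /L2 /L2norm /Bform /Fform -muE.
pose g := gamma_trunc A delta chi.
have mS : measurable (Os Omega_s : set (Rd R n)) := measurable_Os oO.
have mC := measurable_Oc delta chi lam0 oO lipA ellA.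
have g0 x y : 0 <= g x y by exact: gamma_trunc_ge0.
have mg : measurable_fun setT (fun z => g z.1 z.2) := measurable_gamma_trunc delta chi lam0 lipA ellA.
have SC : Os Omega_s `&` Oc A delta chi Omega_s = set0.
  by apply/seteqP; split => // x [Sx [nSx _]].
have M0 : 0 < 2 / delta ^+ 2 by rewrite divr_gt0// exprn_gt0.
move=> hyp L2f.
exact: (nonlocal_well_posed g0 mg mS mC SC M0 K10 K20
  (fun x Ox => let: And4 h _ _ _ := hyp x Ox in h)
  (fun x Ox => let: And4 _ h _ _ := hyp x Ox in h)
  (fun x Ox => let: And4 _ _ h _ := hyp x Ox in h)
  (fun x Ox => let: And4 _ _ _ h := hyp x Ox in h) L2f).
Qed.
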